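(* Let $1\le m<\infty$, let $1\le p<\infty$, let $\Lambda=\{\lambda_{\alpha}\}_{\alpha\in A_m}$ be a weight set for $A_m$ satisfying $( * )$ and $( ** )_p$, and let $1\le k<\infty$. Let $\mathcal{S}$ be the submodule of $\mathcal{M}_\Lambda\otimes\mathbb{C}^k$ generated by a set of monomials $\{Z^{\alpha}\otimes x_{\alpha}\}_{\alpha\in C}$, where $C\subset A_m$ and $\{x_\alpha\}_{\alpha\in C}\subset\mathbb{C}^k$. Then the cross-commutators on $\mathcal{S}$ of the coordinate functions and their adjoints lie in the Schatten $p$-class; that is, if $Y_i$ denotes the restriction to $\mathcal{S}$ of the action of $z_i$, then $[Y_i,Y_j^*]\in\mathcal{C}_p$ for all $1\le i,j\le m$.
   Context: $A_m$ is the set of multi-indices $\alpha=(\alpha_1,\dots,\alpha_m)$ of non-negative integers, $e_i$ is the multi-index with $1$ in position $i$ and $0$ elsewhere, and $Z^{\alpha}=z_1^{\alpha_1}\cdots z_m^{\alpha_m}$ in $\mathbb{C}[z]=\mathbb{C}[z_1,\dots,z_m]$. A weight set is a family $\Lambda=\{\lambda_\alpha\}_{\alpha\in A_m}$ with $0<\lambda_\alpha<\infty$. $\mathcal{M}_\Lambda$ is the Hilbert space completion of $\mathbb{C}[z]$ in which the monomials $\{Z^\alpha\}_{\alpha\in A_m}$ form an orthogonal set (with dense span) and $\|Z^\alpha\|=\lambda_\alpha$. $Z_i$ denotes the operator on $\mathcal{M}_\Lambda$ of multiplication by $z_i$, i.e. $Z_iZ^\alpha=Z^{\alpha+e_i}$.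 $\mathcal{C}_p$ denotes the Schatten $p$-class. Condition $( * )$: $\lambda_\alpha\ge\lambda_{\alpha+e_i}$ for all $\alpha\in A_m$ and $1\le i\le m$ (so each $Z_i$ is a contraction and $\mathcal{M}_\Lambda$ is a Hilbert module over $\mathbb{C}[z]$). Condition $( ** )_p$: the cross-commutator $[Z_i,Z_j^*]$ is in $\mathcal{C}_p$ for all $1\le i,j\le m$. $\mathcal{M}_\Lambda\otimes\mathbb{C}^k$ is the Hilbert module over $\mathbb{C}[z]$ on which $z_i$ acts by $Z_i\otimes I_{\mathbb{C}^k}$. A submodule is a closed subspace invariant under the module action; the submodule generated by a set is the smallest submodule containing it. The adjoint $Y_j^*$ is taken on the Hilbert space $\mathcal{S}$. *)

(* Defs.v *)
From HB Require Import structures.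
From mathcomp Require Import all_boot all_order all_algebra.
From mathcomp Require Import sesquilinear.
From mathcomp Require Import all_classical all_reals all_analysis.
From mathcomp Require Import complex lra ring.

Set Implicit Arguments.
Unset Strict Implicit.
Unset Printing Implicit Defensive.
Import Order.TTheory GRing.Theory Num.Theory.
Import numFieldNormedType.Exports.
Local Open Scope classical_set_scope.
Local Open Scope complex_scope.
Local Open Scope ring_scope.

(* Inner products are linear in the first argument; norms are valued in the
   nonnegative reals of [R[i]]. *)
HB.mixin Record isHilbert (R : realType) H & CompleteNormedModule R[i] H := {
  inner : {dot H for (@Num.conj R[i])};
  inner_norm : forall x : H, `|x| ^+ 2 = inner x x
}.
#[short(type="hilbertType")]
HB.structure Definition Hilbert (R : realType) :=
  {H of isHilbert R H & CompleteNormedModule R[i] H}.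

Notation "''[' x , y ]" := (inner x y) (format "''[' x ,  y ]") : ring_scope.

Section Subspaces.
Variables (R : realType) (H : hilbertType R).
Implicit Types (S G : set H).

Definition subspace S := GRing.submod_closed (mem S).

Definition closed_subspace S := closed S /\ subspace S.

Definition lspan G : set H := smallest subspace G.

End Subspaces.

(* A closed subspace [S] of a Hilbert space is itself a Hilbert space; an
   operator on it is represented by a function on the ambient space, of which
   only the values on [S] matter. In particular the restriction to [S] of an
   operator leaving [S] invariant is represented by the same function. *)
Section Operators.
Variables (R : realType) (H : hilbertType R).
Implicit Types (S : set H) (T : H -> H) (p : R).

Definition bounded_operator S T :=
  [/\ forall x, S x -> S (T x),
      forall a x y, S x -> S y -> T (a *: x + y) = a *: T x + T y
    & exists M : R, forall x, S x -> `|T x| <= M%:C * `|x| ].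

(* The adjoint of [T] on the Hilbert space [S]: [adjoint S T y] is the unique
   [z] in [S] such that ['[T x, y] = '[x, z]] for all [x] in [S]; see
   [adjointP] for its existence. *)
Definition adjoint S T (y : H) : H :=
  xget 0 [set z | S z /\ forall x, S x -> '[T x, y] = '[x, z]].

Definition commutator (A B : H -> H) (x : H) : H := A (B x) - B (A x).

Definition orthonormal_basis S (I : choiceType) (e : I -> H) :=
  [/\ forall i, S (e i),
      forall i j, '[e i, e j] = (i == j)%:R
    & closure (lspan (range e)) = S].

(* [T^* T] is diagonal in some orthonormal basis of [S], with entries
   [s i ^+ 2]; the [s i] are then the singular values of [T] counted with
   multiplicity, and they are required to be p-summable (which entails that
   [T] is compact). *)
Definition schatten S p T :=
  bounded_operator S T /\
  exists (I : choiceType) (e : I -> H) (s : I -> R),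
    [/\ orthonormal_basis S e,
        forall i, 0 <= s i,
        forall i, adjoint S T (T (e i)) = (s i ^+ 2)%:C *: e i
      & (\esum_(i in [set: I]) (s i `^ p)%:E < +oo)%E].

End Operators.

Section Adjoint.
Variables (R : realType) (H : hilbertType R).
Implicit Types (S : set H) (T : H -> H).

Let re (x y : H) : R := complex.Re '[x, y].

Let ReD (a b : R[i]) : complex.Re (a + b) = complex.Re a + complex.Re b.
Proof. by case: a; case: b. Qed.

Let ReJ (c : R[i]) : complex.Re (Num.conj c) = complex.Re c.
Proof. by case: c. Qed.

Let reC x y : re x y = re y x.
Proof. by rewrite /re [in LHS]hermC mul1r; exact: ReJ. Qed.

Let reD x y z : re (x + y) z = re x z + re y z.
Proof. by rewrite /re linearDl /= ReD. Qed.

Let reZ (a : R) x y : re (a%:C *: x) y = a * re x y.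
Proof. by rewrite /re linearZl_LR /=; case: '[x, y] => u v /=; rewrite mul0r subr0. Qed.

Let reDr x y z : re z (x + y) = re z x + re z y.
Proof. by rewrite !(reC z) reD. Qed.

Let reZr (a : R) x y : re y (a%:C *: x) = a * re y x.
Proof. by rewrite !(reC y) reZ. Qed.

Let reN x : `|x| ^+ 2 = (re x x)%:C.
Proof.
rewrite inner_norm /re RRe_real //; apply: ger0_real; exact: dnorm_ge0.
Qed.

Let re_ge0 x : 0 <= re x x.
Proof. by rewrite -lecR -reN exprn_ge0. Qed.

Let subE x y : x - y = x + (-1)%:C *: y :> H.
Proof. by rewrite rmorphN1 scaleN1r. Qed.

Let expand := (subE, reD, reDr, reZ, reZr).

Lemma riesz S T (y : H) : closed_subspace S -> bounded_operator S T ->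
  exists2 z, S z & forall x, S x -> '[T x, y] = '[x, z].
Proof.
move=> [cS [S0 SD]] [_ Tlin [M TM]].
have {}S0 : S 0 by move: S0; rewrite in_setE.
have {}SD a x z : S x -> S z -> S (a *: x + z).
  by move=> Sx Sz; move: (SD a x z); rewrite !in_setE; exact.
pose f x := re x x - 2 * re (T x) y.
have fge x : S x -> - ((M ^+ 2 + 1) * re y y) <= f x.
  move=> Sx; have : `|T x| ^+ 2 <= (M%:C * `|x|) ^+ 2.
    by rewrite ler_sqr ?nnegrE ?TM // (le_trans _ (TM _ Sx)).
  rewrite exprMn !reN -rmorphXn -rmorphM lecR /f => h.
  have M1 : 0 < M ^+ 2 + 1 by rewrite ltr_wpDl ?sqr_ge0.
  have := re_ge0 (T x - (M ^+ 2 + 1)%:C *: y); rewrite !subE !expand (reC y (T x)) => h2.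
  have := re_ge0 x; move: (re_ge0 y) h2 h M1; rewrite /f.
  set q := M ^+ 2 + 1; have -> : M ^+ 2 = q - 1 by rewrite /q; ring.
  move: (re x x) (re y y) (re (T x) (T x)) (re (T x) y) => a b c d b0 h2 h q0 a0.
  rewrite -(ler_pM2l q0); nra.
pose I := inf (f @` S).
have hinf : has_inf (f @` S).
  split; first by exists (f 0), 0.
  by exists (- ((M ^+ 2 + 1) * re y y)) => _ [x Sx <-]; exact: fge.
have fI x : S x -> I <= f x by move=> Sx; apply: ge_inf; [exact: hinf.2|exists x].
have ex n : exists a, S a /\ f a < I + n.+1%:R^-1.
  have n0 : 0 < n.+1%:R^-1 :> R by rewrite invr_gt0.
  by have [_ [a Sa <-] h] := inf_adherent n0 hinf; exists a.
have [a /all_and2[Sa fa]] := choice ex.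
have par x z : S x -> S z ->
    re (x - z) (x - z) <= 2 * (f x - I) + 2 * (f z - I).
  move=> Sx Sz.
  have S2 : S ((2^-1)%:C *: x + ((2^-1)%:C *: z + 0)) by apply: (SD) => //; apply: SD.
  have := fI _ S2; rewrite /f addr0 Tlin //; last first.
    by rewrite -[_ *: z]addr0; exact: SD.
  have -> : T ((2^-1)%:C *: z) = (2^-1)%:C *: T z.
    have T0 : T 0 = 0.
      have := Tlin (1 : R[i]) 0 0 S0 S0.
      by rewrite !scale1r addr0 => h; apply: (addrI (T 0)); rewrite addr0 -h.
    by rewrite -[in LHS](addr0 ((2^-1)%:C *: z)) Tlin // T0 addr0.
  rewrite !subE !expand (reC z x); lra.
have sqr_lt (w : H) (d : R) : 0 < d -> re w w < d ^+ 2 -> `|w| < d%:C.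
  move=> d0 h; rewrite -ltr_sqr ?nnegrE ?normr_ge0 ?lecR ?(ltW d0) //.
  by rewrite reN -rmorphXn ltcR.
have lt_sqr : forall (u : H) (d : R), 0 < d -> (`|u| < d%:C) -> re u u < d ^+ 2.
move=> u d d0.
  rewrite -ltr_sqr ?nnegrE ?normr_ge0 ?lecR ?(ltW d0) //.
  by rewrite reN -rmorphXn ltcR.
have ca : cauchy (a @ \oo).
  apply/cauchyP => e e0.
  have [d de d0] : exists2 d : R, d%:C = e & 0 < d.
    have er : (complex.Re e)%:C = e by rewrite RRe_real // gtr0_real.
    by exists (complex.Re e) => //; rewrite -ltcR er.
  have d2 : 0 < d ^+ 2 / 4 by rewrite divr_gt0 // exprn_gt0.
  near \oo => n; exists (a n).
  change (\forall k \near \oo, ball (a n) e (a k)); near=> k.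
  rewrite -ball_normE /ball_ /= -de; apply: sqr_lt => //.
  apply: (le_lt_trans (par _ _ (Sa n) (Sa k))).
  have fn := fa n; have fk := fa k.
  have : n.+1%:R^-1 < d ^+ 2 / 4 by near: n; exact: near_infty_natSinv_lt (PosNum d2).
  have : k.+1%:R^-1 < d ^+ 2 / 4 by near: k; exact: near_infty_natSinv_lt (PosNum d2).
  move: fn fk; move: (f (a n)) (f (a k)) (n.+1%:R^-1) (k.+1%:R^-1) (d ^+ 2) => u v w1 w2 dd; lra.
have caa : cvg (a @ \oo) by apply: cauchy_cvg.
have [z az] : exists z : H, a @ \oo --> z by exists (lim (a @ \oo)).
have Sz : S z by apply: (closed_cvg S cS _ _ az); exact: nearW.
exists z => // h Sh.
have crit g : S g -> re (T g) y = re g z.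
  move=> Sg; apply/esym/eqP; rewrite -subr_eq0; apply/eqP.
  set r := _ - _.
  have key t : 0 <= 2 * t ^+ 2 * re g g + 2 * t * r.
    apply/ler_addgt0Pr => e e0.
    pose d := Num.sqrt (e / 2).
    have e2 : 0 < e / 2 by rewrite divr_gt0.
    have d0 : 0 < d by rewrite sqrtr_gt0.
    near \oo => n.
    have hn : n.+1%:R^-1 < e / 2 by near: n; exact: near_infty_natSinv_lt (PosNum e2).
    have : re (z - a n) (z - a n) < d ^+ 2.
      apply: lt_sqr => //; near: n; move: az => /cvgrPdist_lt; apply.
      by rewrite ltcR.
    rewrite (sqr_sqrtr (ltW e2)) => hw.
    have := fI _ (SD t%:C _ _ Sg (Sa n)); have := fa n.
    rewrite /f Tlin // !expand (reC (a n) g).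
    move: hw; have [w wE] : exists w, w = z - a n by exists (z - a n).
    rewrite -wE => hw; have := re_ge0 (t%:C *: g + w).
    rewrite !expand (reC w g).
    have -> : re g (a n) = re g z - re g w by rewrite wE subE !expand; ring.
    move: hw hn; rewrite /r.
    move: (re g w) (re w w) (re g z) (re g g) (re (T g) y) (re (T (a n)) y) (re (a n) (a n)) (n.+1%:R^-1) => b1 b2 b3 b4 b5 b6 b7 b8.
    lra.
  have G := re_ge0 g; set N := re g g in key G.
  have := key (- r / (2 * N + 1)).
  have q0 : 0 < (2 * N + 1)^-1 by rewrite invr_gt0; lra.
  have qE : (2 * N + 1) * (2 * N + 1)^-1 = 1 by rewrite mulfV // gt_eqF //; lra.
  move: ((2 * N + 1)^-1) q0 qE => q q0 qE hk.
  have E : 2 * (- r * q) ^+ 2 * N + 2 * (- r * q) * r = - (r ^+ 2 * (q * (2 - 2 * N * q))) by ring.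
  have q1 : 2 - 2 * N * q = 1 + q.
    by have : 2 * N * q + q = 1 by [rewrite -[RHS]qE; ring]; lra.
  move: hk; rewrite E q1 oppr_ge0 => hk; apply/eqP; rewrite -sqrf_eq0 eq_le sqr_ge0 andbT.
  by rewrite -(pmulr_lle0 _ (_ : 0 < q * (1 + q))) // mulr_gt0 // addr_gt0.
apply/eqP; rewrite eq_complex; apply/andP; split; apply/eqP.
  exact: crit.
have T0 : T 0 = 0.
  have := Tlin (1 : R[i]) 0 0 S0 S0.
  by rewrite !scale1r addr0 => eT; apply: (addrI (T 0)); rewrite addr0 -eT.
have := crit _ (SD 'i%C _ _ Sh S0).
rewrite Tlin // T0 !addr0 /re !linearZl_LR /=.
by case: '[T h, y] => u v; case: '[h, z] => u' v' /=; rewrite !mul0r !mul1r !sub0r => /oppr_inj.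
Unshelve. all: by end_near. Qed.

Lemma adjointP S T (y : H) : closed_subspace S -> bounded_operator S T ->
  S (adjoint S T y) /\ forall x, S x -> '[T x, y] = '[x, adjoint S T y].
Proof.
move=> cS bT; have [z Sz zP] := riesz y cS bT; rewrite /adjoint.
by case: xgetP => [w _ [] //|/(_ z) []].
Qed.

Lemma adjoint_unique S T (y z : H) : closed_subspace S ->
  S z -> (forall x, S x -> '[T x, y] = '[x, z]) -> adjoint S T y = z.
Proof.
move=> [_ [_ SD]] Sz zP; rewrite /adjoint.
case: xgetP => [w _ [Sw wP]|/(_ z) []//].
have Swz : S (w - z).
  by move: (SD (-1) z w); rewrite scaleN1r addrC !in_setE; exact.
apply/eqP; rewrite -subr_eq0 -(dnorm_eq0 (inner : {dot H for @Num.conj R[i]})).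
by rewrite linearBr /= -zP // -wP // subrr.
Qed.
End Adjoint.

Definition multi_index (m : nat) := {ffun 'I_m -> nat}.

Definition unit_index m (i : 'I_m) : multi_index m :=
  [ffun j => nat_of_bool (j == i)].

Section WeightedModules.
Variables (R : realType) (m k : nat).
Implicit Types (M H : hilbertType R).

(* [M] is the completion of the polynomials for the weights [lam], [Z a] being
   the monomial of multi-index [a]; this determines [M] and [Z] up to a unitary
   isomorphism. *)
Definition weighted_completion (lam : multi_index m -> R) M
    (Z : multi_index m -> M) :=
  [/\ forall a b, a != b -> '[Z a, Z b] = 0,
      forall a, `|Z a| = (lam a)%:C
    & dense (lspan (range Z))].

(* A bounded operator is determined by its values on the monomials. *)
Definition coordinate_operators M (Z : multi_index m -> M)
    (Zop : 'I_m -> M -> M) :=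
  forall i, bounded_operator setT (Zop i) /\
            forall a, Zop i (Z a) = Z (a + unit_index i).

(* [H] is the Hilbert space tensor product of [M] and [C^k], the latter with
   its standard inner product; [tens x u] is the elementary tensor. *)
Definition hilbert_tensor M H (tens : {bilinear M -> 'rV[R[i]]_k -> H}) :=
  (forall x y u v,
     '[tens x u, tens y v] = '[x, y] * \sum_(l < k) u 0 l * Num.conj (v 0 l)) /\
  dense (lspan [set tens xu.1 xu.2 | xu in [set: M * 'rV[R[i]]_k]]).

(* [T i] is the tensor product of [Zop i] with the identity of [C^k]. *)
Definition tensored_operators M H (tens : {bilinear M -> 'rV[R[i]]_k -> H})
    (Zop : 'I_m -> M -> M) (T : 'I_m -> H -> H) :=
  forall i, bounded_operator setT (T i) /\
            forall x u, T i (tens x u) = tens (Zop i x) u.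

(* [T i] is the action of the [i]-th coordinate function. A linear subspace is
   invariant under all polynomials as soon as it is invariant under these. *)
Definition submodule H (T : 'I_m -> H -> H) (S : set H) :=
  closed_subspace S /\ forall i x, S x -> S (T i x).

Definition generated_submodule H (T : 'I_m -> H -> H) (G : set H) : set H :=
  smallest (submodule T) G.

End WeightedModules.

(* Main.v *)
(* Let [V a] be the space of all [v] with [Z^a (x) v] in [S]. It grows with
   [a], [S] is the orthogonal sum of the spaces [Z^a (x) V a], and [[Y_i, Y_j^*]]
   maps [Z^a (x) V a] into [Z^(a + e_i - e_j) (x) C^k]. If [P a] denotes the
   orthogonal projection onto [V a], this block is the coefficient of
   [[Z_i, Z_j^*]] times a projection, plus a term which vanishes unless both
   steps from [V (a - e_j)] to [V (a - e_j + e_i)] and to [V a] are proper. By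
   Dickson's lemma proper steps in direction [i] only occur for bounded [a i].
   For such [a] the ratios [lam (a + e_i) ^ 2 / lam a ^ 2] are sums of boundedly
   many coefficients of [[Z_i, Z_i^*]], hence p-summable, and by AM-GM they
   dominate the extra term. Since the blocks have rank at most [k], p-summable
   block norms suffice. *)
Require Import Defs.
From mathcomp Require Import all_boot all_order all_algebra.
From mathcomp Require Import sesquilinear spectral.
From mathcomp Require Import all_classical all_reals all_analysis.
From mathcomp Require Import complex lra ring.

Set Implicit Arguments.
Unset Strict Implicit.
Unset Printing Implicit Defensive.
Import Order.TTheory GRing.Theory Num.Theory.
Import numFieldNormedType.Exports.
Local Open Scope classical_set_scope.
Local Open Scope complex_scope.
Local Open Scope ring_scope.

Lemma conjR (R : realType) (r : R) : Num.conj r%:C = r%:C.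
Proof. by apply/CrealP; rewrite complex_real. Qed.

(** * Hilbert space geometry: subspaces, closed spans, bounded operators and adjoints *)

Section Hilbert.
Variables (R : realType) (H : hilbertType R).
Implicit Types (S G : set H) (T : H -> H) (x y z : H).

(** Norms take values in [R[i]]; this real copy is what real order reasoning and [powR] apply to. *)
Definition rnorm x : R := complex.Re `|x|.

Lemma rnormE x : `|x| = (rnorm x)%:C.
Proof. by rewrite /rnorm RRe_real ?ger0_real ?normr_ge0. Qed.

Lemma rnorm_ge0 x : 0 <= rnorm x.
Proof. by rewrite -lecR -rnormE; exact: normr_ge0. Qed.

Lemma rnorm_sqr x : '[x, x] = (rnorm x ^+ 2)%:C.
Proof. by rewrite -inner_norm rnormE rmorphXn. Qed.

Lemma rnorm0 : rnorm 0 = 0.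
Proof. by rewrite /rnorm normr0. Qed.

Lemma rnorm_eq0 x : rnorm x = 0 -> x = 0.
Proof. by move=> h; apply/eqP; rewrite -normr_eq0 rnormE h. Qed.

Lemma ler_rnormD x y : rnorm (x + y) <= rnorm x + rnorm y.
Proof. by rewrite -lecR rmorphD /= -!rnormE ler_normD. Qed.

Lemma rnormN x : rnorm (- x) = rnorm x.
Proof. by rewrite /rnorm normrN. Qed.

Lemma innerC x y : '[x, y] = Num.conj '[y, x].
Proof. by rewrite [in LHS]hermC mul1r. Qed.

Lemma innerDl x y z : '[x + y, z] = '[x, z] + '[y, z].
Proof. exact: linearDl. Qed.
Lemma innerZl a x z : '[a *: x, z] = a * '[x, z].
Proof. exact: linearZl_LR. Qed.
Lemma innerBl x y z : '[x - y, z] = '[x, z] - '[y, z].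
Proof. exact: linearBl. Qed.
Lemma inner0l z : '[0, z] = 0.
Proof. exact: linear0l. Qed.
Lemma innerDr x y z : '[z, x + y] = '[z, x] + '[z, y].
Proof. exact: linearDr. Qed.
Lemma innerZr a x z : '[z, a *: x] = Num.conj a * '[z, x].
Proof. exact: linearZr_LR. Qed.
Lemma innerBr x y z : '[z, x - y] = '[z, x] - '[z, y].
Proof. exact: linearBr. Qed.
Lemma inner_suml (I : Type) (r : seq I) (F : I -> H) z :
  '[\sum_(i <- r) F i, z] = \sum_(i <- r) '[F i, z].
Proof. exact: linear_sumlz. Qed.
Lemma inner_sumr (I : Type) (r : seq I) (F : I -> H) z :
  '[z, \sum_(i <- r) F i] = \sum_(i <- r) '[z, F i].
Proof. exact: linear_sumr. Qed.

Lemma rnorm_pythagoras x y : '[x, y] = 0 ->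
  rnorm (x + y) ^+ 2 = rnorm x ^+ 2 + rnorm y ^+ 2.
Proof.
move=> xy; apply: complexI; rewrite rmorphD /= -!rnorm_sqr innerDl !innerDr xy.
by rewrite (innerC y) xy rmorph0 addr0 add0r.
Qed.

Lemma subspaceP S : Defs.subspace S <->
  S 0 /\ forall a x y, S x -> S y -> S (a *: x + y).
Proof.
split=> -[S0 SD]; split.
- by move: S0; rewrite in_setE.
- by move=> a x y Sx Sy; move: (SD a x y); rewrite !in_setE; exact.
- by rewrite in_setE.
- by move=> a x y; rewrite !in_setE; exact: SD.
Qed.

Lemma subspaceZ S a x : Defs.subspace S -> S x -> S (a *: x).
Proof.
by move=> /subspaceP[S0 SD] Sx; rewrite -[_ *: _]addr0; exact: SD.
Qed.

Lemma subspaceD S x y : Defs.subspace S -> S x -> S y -> S (x + y).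
Proof.
by move=> /subspaceP[S0 SD] Sx Sy; rewrite -[x]scale1r; exact: SD.
Qed.

Lemma subspaceB S x y : Defs.subspace S -> S x -> S y -> S (x - y).
Proof.
move=> sS Sx Sy; rewrite -scaleN1r; apply: subspaceD => //; exact: subspaceZ.
Qed.

Lemma subspace_sum S (I : Type) (r : seq I) (F : I -> H) : Defs.subspace S ->
  (forall i, S (F i)) -> S (\sum_(i <- r) F i).
Proof.
move=> sS SF; elim/big_ind: _ => //; first by case/subspaceP: sS.
by move=> x y; exact: subspaceD.
Qed.

Lemma subspace_lspan G : Defs.subspace (lspan G).
Proof.
apply/subspaceP; split=> [S [/subspaceP[]//]|a x y Gx Gy S [sS GS]].
by case/subspaceP: (sS) => _; apply; [exact: Gx|exact: Gy].
Qed.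

Lemma closure_normP S x :
  closure S x <-> forall e : R, 0 < e -> exists2 y, S y & rnorm (x - y) < e.
Proof.
split=> [cx e e0|hx B].
  have [|y [Sy]] := cx (ball x e%:C).
    by apply: nbhsx_ballx; rewrite ltcR.
  rewrite -ball_normE /ball_ /= rnormE ltcR => h; by exists y.
rewrite nbhs_ballP => -[e /= e0 eB].
have er : (complex.Re e)%:C = e by rewrite RRe_real // gtr0_real.
have [|y Sy xy] := hx (complex.Re e); first by rewrite -ltcR er.
exists y; split=> //; apply: eB; rewrite -ball_normE /ball_ /= rnormE.
by rewrite -er ltcR.
Qed.

Lemma rnormZ (a : R[i]) x : rnorm (a *: x) = complex.Re `|a| * rnorm x.
Proof.
apply: complexI; rewrite rmorphM /= -!rnormE normrZ; congr (_ * _).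
Qed.

Lemma rnormZR (a : R) x : rnorm (a%:C *: x) = `|a| * rnorm x.
Proof.
by rewrite rnormZ normc_def /= expr0n addr0 sqrtr_sqr.
Qed.

Lemma subspace_closure S : Defs.subspace S -> Defs.subspace (closure S).
Proof.
move=> /subspaceP[S0 SD]; apply/subspaceP; split; first exact: subset_closure.
move=> a x y /closure_normP cx /closure_normP cy; apply/closure_normP => e e0.
pose A := complex.Re `|a|.
have A0 : 0 <= A by rewrite -lecR; exact: (normr_ge0 a).
(* The denominator [A + 1] covers the case [a = 0]. *)
have [|x' Sx' xx'] := cx (e / 2 / (A + 1)); first by rewrite !divr_gt0 // ltr_wpDl.
have [|y' Sy' yy'] := cy (e / 2); first by rewrite divr_gt0.
exists (a *: x' + y'); first exact: SD.
rewrite opprD addrACA -scalerBr (le_lt_trans (ler_rnormD _ _)) // rnormZ -/A.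
rewrite ltr_pdivlMr ?ltr_wpDl // in xx'.
have := rnorm_ge0 (x - x'); nra.
Qed.

Lemma closed_subspace_closure S : Defs.subspace S -> closed_subspace (closure S).
Proof. by move=> sS; split; [exact: closed_closure|exact: subspace_closure]. Qed.

Lemma closure_lspan_sub S G : closed_subspace S -> G `<=` S ->
  closure (lspan G) `<=` S.
Proof.
move=> [cS sS] GS; rewrite (closure_id S).1 //; apply: closure_subset.
exact: smallest_sub.
Qed.

Lemma dense_closure S : dense S -> closure S = setT.
Proof.
move=> dS; apply/seteqP; split=> // x _ B; rewrite nbhsE /= => -[U [oU Ux] UB].
have [|y [Uy Sy]] := dS U _ oU; first by exists x.
by exists y; split=> //; exact: UB.
Qed.

(** Some [x] in the span is within [e] of [y] and orthogonal to it, so Pythagoras bounds [rnorm y]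
    by the distance from [y] to [x]. *)
Lemma orthogonal_closure_lspan G y : closure (lspan G) y ->
  (forall g, G g -> '[g, y] = 0) -> y = 0.
Proof.
move=> cy Gy; have Ly : lspan G `<=` [set x | '[x, y] = 0].
  apply: smallest_sub => //; apply/subspaceP; split=> [|a u v /= u0 v0] /=.
    by rewrite inner0l.
  by rewrite innerDl innerZl u0 v0 mulr0 addr0.
apply: rnorm_eq0; apply/eqP; rewrite eq_le rnorm_ge0 andbT.
apply/ler_addgt0Pr => e e0; rewrite add0r.
have /closure_normP/(_ _ e0)[x /Ly/= xy h] := cy.
apply: ltW (le_lt_trans _ h); rewrite -ler_sqr ?nnegrE ?rnorm_ge0 //.
rewrite rnorm_pythagoras ?lerDl ?sqr_ge0 //.
by rewrite -scaleN1r innerZr innerC xy rmorph0 mulr0.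
Qed.

Lemma inner_closure_lspan_inj G y z :
  closure (lspan G) y -> closure (lspan G) z ->
  (forall g, G g -> '[g, y] = '[g, z]) -> y = z.
Proof.
move=> cy cz yz; apply/eqP; rewrite -subr_eq0; apply/eqP.
apply: (@orthogonal_closure_lspan G); last first.
  by move=> g Gg; rewrite innerBr yz // subrr.
exact: (subspaceB (subspace_closure (subspace_lspan G)) cy cz).
Qed.

Lemma closed_subspaceT : closed_subspace [set: H].
Proof. by split; [exact: closedT|apply/subspaceP]. Qed.

(** Values of an adjoint need testing only on a generating set; for [S] this will be its
    monomials. *)
Lemma adjointE S T G y w : closed_subspace S -> bounded_operator S T ->
  S = closure (lspan G) -> S w ->
  (forall g, G g -> '[T g, y] = '[g, w]) -> adjoint S T y = w.
Proof.
move=> cS bT SE Sw hw; have [Sa ha] := adjointP y cS bT.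
apply: (@inner_closure_lspan_inj G); rewrite -?SE // => g Gg.
by rewrite -hw // ha // SE; apply: subset_closure; exact: sub_gen_smallest.
Qed.

Lemma bounded_linear S T a x y : bounded_operator S T -> S x -> S y ->
  T (a *: x + y) = a *: T x + T y.
Proof. by case=> _ TL _; exact: TL. Qed.

Lemma bounded_linear0 S T : S 0 -> bounded_operator S T -> T 0 = 0.
Proof.
move=> S0 bT; have := bounded_linear 1 bT S0 S0.
by rewrite !scale1r addr0 => h; apply: (addrI (T 0)); rewrite addr0 -h.
Qed.

Lemma bounded_linearZ S T a x : S 0 -> bounded_operator S T -> S x ->
  T (a *: x) = a *: T x.
Proof.
move=> S0 bT Sx; have := bounded_linear a bT Sx S0.
by rewrite addr0 (bounded_linear0 S0 bT) addr0.
Qed.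

Lemma bounded_operatorP S T : bounded_operator S T <->
  [/\ forall x, S x -> S (T x),
      forall a x y, S x -> S y -> T (a *: x + y) = a *: T x + T y
    & exists2 M : R, 0 <= M & forall x, S x -> rnorm (T x) <= M * rnorm x].
Proof.
split=> -[h1 h2]; last first.
  move=> [M M0 TM]; split=> //; exists M => x /TM.
  by rewrite !rnormE -rmorphM lecR.
move=> [M TM]; split=> //; exists `|M| => // x /TM.
rewrite !rnormE -rmorphM lecR => /le_trans; apply.
by rewrite ler_wpM2r ?rnorm_ge0 ?ler_norm.
Qed.

Lemma closure_lspan_invariant T G : bounded_operator setT T ->
  (forall g, G g -> G (T g)) ->
  forall x, closure (lspan G) x -> closure (lspan G) (T x).
Proof.
move=> bT GT x /closure_normP cx; apply/closure_normP => d d0.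
case/bounded_operatorP: (bT) => _ TL [K K0 TK].
have LT y : lspan G y -> lspan G (T y).
  move=> Ly; suff : lspan G `<=` [set z | lspan G (T z)] by apply.
  have /subspaceP[L0 LD] := subspace_lspan G.
  apply: smallest_sub => [|g /GT]; last exact: sub_gen_smallest.
  apply/subspaceP; split=> [|a u v Lu Lv] /=.
    by rewrite (bounded_linear0 _ bT).
  by rewrite TL //; exact: LD.
have [|y Ly xy] := cx (d / (K + 1)); first by rewrite divr_gt0 // ltr_wpDl.
exists (T y); first exact: LT.
have -> : T x - T y = T (x - y).
  by rewrite -!(scaleN1r y) -scaleN1r addrC -TL // addrC.
rewrite ltr_pdivlMr ?ltr_wpDl // in xy.
apply: le_lt_trans (TK _ I) _; have := rnorm_ge0 (x - y); nra.
Qed.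

Lemma bounded_comp S T1 T2 : bounded_operator S T1 -> bounded_operator S T2 ->
  bounded_operator S (T1 \o T2).
Proof.
move=> /bounded_operatorP[S1 L1 [M1 M10 B1]] /bounded_operatorP[S2 L2 [M2 M20 B2]].
apply/bounded_operatorP; split=> [x /S2/S1//|a x y Sx Sy /=|].
  by rewrite L2 // L1 //; exact: S2.
exists (M1 * M2) => [|x Sx /=]; first exact: mulr_ge0.
by rewrite (le_trans (B1 _ (S2 _ Sx))) // -mulrA ler_wpM2l // B2.
Qed.

Lemma bounded_sub S T1 T2 : Defs.subspace S ->
  bounded_operator S T1 -> bounded_operator S T2 ->
  bounded_operator S (fun x => T1 x - T2 x).
Proof.
move=> sS /bounded_operatorP[S1 L1 [M1 M10 B1]].
move=> /bounded_operatorP[S2 L2 [M2 M20 B2]].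
apply/bounded_operatorP; split=> [x Sx|a x y Sx Sy|].
- by apply: subspaceB; [exact: sS|exact: S1|exact: S2].
- by rewrite L1 // L2 // scalerBr opprD addrACA.
exists (M1 + M2) => [|x Sx]; first exact: addr_ge0.
by rewrite (le_trans (ler_rnormD _ _)) // rnormN mulrDl lerD ?B1 ?B2.
Qed.

Lemma bounded_adjoint S T : closed_subspace S -> bounded_operator S T ->
  bounded_operator S (adjoint S T).
Proof.
move=> cS bT; have sS := cS.2.
case/bounded_operatorP: (bT) => ST LT [M M0 BT].
have aP y := adjointP y cS bT.
apply/bounded_operatorP; split=> [x _|a x y Sx Sy|]; first exact: (aP x).1.
  apply: adjoint_unique => //.
    by case/subspaceP: sS => _; apply; exact: (aP _).1.
  by move=> z Sz; rewrite !innerDr !innerZr !(aP _).2.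
exists (M ^+ 2 + 1) => [|y Sy]; first by rewrite addr_ge0 ?sqr_ge0.
set z := adjoint S T y; have Sz : S z := (aP y).1.
have h1 := (aP y).2 _ Sz; rewrite -/z rnorm_sqr in h1.
have h2 := BT _ Sz.
(* In place of Cauchy-Schwarz, expand the squared norm of [T z - t%:C *: y]. Since [rnorm (T z) ^+ 2
   <= (t - 1) * rnorm z ^+ 2], its nonnegativity gives [(t + 1) * rnorm z ^+ 2 <= t ^+ 2 * rnorm y
   ^+ 2]. *)
pose t := M ^+ 2 + 1.
have h3 : rnorm (T z - t%:C *: y) ^+ 2 =
    rnorm (T z) ^+ 2 + t ^+ 2 * rnorm y ^+ 2 - 2 * t * rnorm z ^+ 2.
  apply: complexI; rewrite -rnorm_sqr innerBl !innerBr !innerZl !innerZr.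
  rewrite (innerC y) h1 !rnorm_sqr.
  by rewrite !conjR !(rmorphB, rmorphD, rmorphM, rmorphXn, rmorph_nat) /=; ring.
have := sqr_ge0 (rnorm (T z - t%:C *: y)); rewrite h3.
have t1 : 1 <= t by rewrite /t lerDr sqr_ge0.
have h4 : rnorm (T z) ^+ 2 <= (t - 1) * rnorm z ^+ 2.
  by rewrite /t addrK -exprMn ler_sqr ?nnegrE ?mulr_ge0 ?rnorm_ge0.
have t0 : 0 <= t by lra.
move=> h5; rewrite -/t -ler_sqr ?nnegrE ?rnorm_ge0 ?(mulr_ge0 t0 (rnorm_ge0 y)) //.
rewrite exprMn; move: h4 h5; move: (rnorm (T z) ^+ 2) => q.
have := sqr_ge0 (rnorm z); have := sqr_ge0 (rnorm y).
move: (rnorm y) (rnorm z) => u v; move: (u ^+ 2) (v ^+ 2) => uu vv.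
move=> uu0 vv0 h4 h5.
have : (t + 1) * vv <= t ^+ 2 * uu by lra.
by apply: le_trans; rewrite ler_peMl //; lra.
Qed.

Lemma bounded_commutator S A B : Defs.subspace S -> bounded_operator S A ->
  bounded_operator S B -> bounded_operator S (commutator A B).
Proof.
by move=> sS bA bB; apply: (bounded_sub sS); apply: bounded_comp.
Qed.

Lemma submodule_generated (n : nat) (T : 'I_n -> H -> H) G :
  submodule T (generated_submodule T G).
Proof.
split=> [|i x Sx S hS]; last first.
  by have [[_ TS] _] := hS; apply: TS; exact: Sx.
split.
  apply: closed_bigI => S [[[]]] //.
apply/subspaceP; split=> [S [[[_ /subspaceP[]]]]//|a x y Sx Sy S hS].
have [[[_ /subspaceP[_ SD]] _] _] := hS.
by apply: SD; [exact: Sx|exact: Sy].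
Qed.

End Hilbert.

(** * Summable and p-summable families over arbitrary index types *)

Section Summability.
Variable R : realType.

(** Bounding sums over duplicate-free lists avoids extended reals; for nonnegative families
    [summable_family_esum] identifies this with a finite [\esum]. *)
Definition summable_family (I : choiceType) (f : I -> R) :=
  exists K : R, forall s : seq I, uniq s -> \sum_(i <- s) f i <= K.

Implicit Types I J : choiceType.

Lemma summable_family_esum I (f : I -> R) : (forall i, 0 <= f i) ->
  summable_family f <-> (\esum_(i in [set: I]) (f i)%:E < +oo)%E.
Proof.
move=> f0; split=> [[K hK]|h].
  apply: (@le_lt_trans _ _ K%:E); last exact: ltry.
  apply: ge_ereal_sup => _ [X [finX _] <-].
  by rewrite fsbig_finite //= sumEFin lee_fin; apply: hK; exact: finmap.fset_uniq.
have h0 : (0 <= \esum_(i in [set: I]) (f i)%:E)%E.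
  by apply: esum_ge0 => i _; rewrite lee_fin.
exists (fine (\esum_(i in [set: I]) (f i)%:E)) => s us.
rewrite -lee_fin fineK ?ge0_fin_numE // esum_ge //; exists [set` s].
  by split=> //; exact: finite_seq.
by rewrite -fsbig_seq // sumEFin.
Qed.

Lemma summable_familyS I (f g : I -> R) :
  (forall i, f i <= g i) -> summable_family g -> summable_family f.
Proof.
move=> fg [K hK]; exists K => s us.
by apply: le_trans (hK s us); apply: ler_sum.
Qed.

Lemma summable_familyD I (f g : I -> R) : summable_family f ->
  summable_family g -> summable_family (fun i => f i + g i).
Proof.
move=> [K hK] [L hL]; exists (K + L) => s us.
by rewrite big_split lerD ?hK ?hL.
Qed.

Lemma summable_familyZ I (c : R) (f : I -> R) : 0 <= c -> summable_family f ->
  summable_family (fun i => c * f i).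
Proof.
move=> c0 [K hK]; exists (c * K) => s us.
by rewrite -mulr_sumr ler_wpM2l ?hK.
Qed.

Lemma summable_family_sum I (n : nat) (f : 'I_n -> I -> R) :
  (forall l, summable_family (f l)) -> summable_family (fun i => \sum_l f l i).
Proof.
move=> /choice[K hK]; exists (\sum_l K l) => s us.
by rewrite exchange_big ler_sum // => l _; exact: hK.
Qed.

(** The predicate [P] cuts out a set on which [h] is injective: the shifts of multi-indices used
    later are injective only where no subtraction truncates. *)
Lemma summable_family_reindex I J (P : pred I) (h : I -> J) (f : J -> R) :
  {in P &, injective h} -> summable_family f ->
  summable_family (fun i => (P i)%:R * f (h i)).
Proof.
move=> hinj [K hK]; exists K => s us.
have -> : \sum_(i <- s) (P i)%:R * f (h i) =
    \sum_(j <- [seq h i | i <- s & P i]) f j.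
  rewrite big_map big_filter [RHS]big_mkcond /=; apply: eq_bigr => i _.
  by case: (P i); rewrite ?mul1r ?mul0r.
apply: hK; rewrite map_inj_in_uniq ?filter_uniq // => i j.
by rewrite !mem_filter => /andP[Pi _] /andP[Pj _]; exact: hinj.
Qed.

(** Passes from one bound per block to one per basis vector. On the slice where the second component
    is a fixed [l], [tag] is injective, so [k] reindexed copies of [f] dominate. *)
Lemma summable_family_tag I (k : nat) (r : I -> nat) (f : I -> R) :
  (forall i, (r i <= k)%N) -> (forall i, 0 <= f i) -> summable_family f ->
  summable_family (fun u : {i : I & 'I_(r i)} => f (tag u)).
Proof.
move=> rk f0 sf.
apply: (@summable_familyS _ _ (fun u : {i : I & 'I_(r i)} => \sum_(l < k)
    (nat_of_ord (tagged u) == l :> nat)%:R * f (tag u))).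
  move=> u; have uk : (tagged u < k)%N by apply: leq_trans (rk _).
  rewrite (bigD1 (Ordinal uk)) //= eqxx mul1r lerDl sumr_ge0 // => l _.
  by rewrite mulr_ge0.
apply: summable_family_sum => l.
apply: (@summable_family_reindex _ _
  (fun u : {i : I & 'I_(r i)} => nat_of_ord (tagged u) == l)) => //.
move=> [i a] [j b] /eqP /= al /eqP /= bl ij; rewrite /= in ij.
move: b bl; rewrite -ij => b bl; congr (Tagged _ _); apply: val_inj.
by rewrite /= al.
Qed.

(** As [a + b] is at most twice the larger term, this crude constant works for every [p >= 0]
    without convexity. *)
Lemma powRD_le (p a b : R) : 0 <= p -> 0 <= a -> 0 <= b ->
  (a + b) `^ p <= 2 `^ p * (a `^ p + b `^ p).
Proof.
move=> p0 a0 b0; pose c := Num.max a b.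
have c0 : 0 <= c by rewrite /c le_max a0.
have : (a + b) `^ p <= (2 * c) `^ p.
  apply: ge0_ler_powR; rewrite ?nnegrE ?addr_ge0 ?mulr_ge0 //.
  by rewrite mulr_natl mulr2n lerD // /c le_max lexx ?orbT.
move=> /le_trans; apply; rewrite powRM // ler_wpM2l ?powR_ge0 //.
by rewrite /c; case: (leP a b) => _; [rewrite lerDr|rewrite lerDl]; exact: powR_ge0.
Qed.

Definition lp (p : R) I (f : I -> R) := summable_family (fun i => `|f i| `^ p).

Variable p : R.
Hypothesis p0 : 0 < p.

Lemma lpS I (f g : I -> R) : (forall i, `|f i| <= `|g i|) -> lp p g -> lp p f.
Proof.
move=> fg; apply: summable_familyS => i.
by apply: ge0_ler_powR; rewrite ?nnegrE ?(ltW p0).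
Qed.

Lemma lpD I (f g : I -> R) : lp p f -> lp p g -> lp p (fun i => f i + g i).
Proof.
move=> lf lg; apply: (@summable_familyS _ _
   (fun i => 2 `^ p * (`|f i| `^ p + `|g i| `^ p))) => [i|].
  apply: le_trans (powRD_le (ltW p0) _ _) => //.
  by apply: ge0_ler_powR; rewrite ?nnegrE ?(ltW p0) // ler_normD.
by apply: summable_familyZ; [exact: powR_ge0|exact: summable_familyD].
Qed.

Lemma lp_reindex I J (P : pred I) (h : I -> J) (f : J -> R) :
  {in P &, injective h} -> lp p f -> lp p (fun i => (P i)%:R * f (h i)).
Proof.
move=> hinj lf; apply: summable_familyS (summable_family_reindex hinj lf) => i.
case: (P i); rewrite ?mul1r // !mul0r normr0 powR0 //.
by rewrite gt_eqF.
Qed.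

End Summability.

(** * Orthonormal bases, Bessel's inequality and singular values *)

Section Bases.
Variables (R : realType) (H : hilbertType R).
Implicit Types (S : set H) (T : H -> H) (I J : choiceType) (p : R).

Definition sqmod (z : R[i]) : R := complex.Re z ^+ 2 + complex.Im z ^+ 2.

Lemma sqmodE z : (sqmod z)%:C = z * Num.conj z.
Proof.
case: z => a b; rewrite /sqmod /=; apply/eqP; rewrite eq_complex /=.
by apply/andP; split; apply/eqP; ring.
Qed.

Lemma sqmod_ge0 z : 0 <= sqmod z.
Proof. by rewrite addr_ge0 ?sqr_ge0. Qed.

Lemma sqmod_conj z : sqmod (Num.conj z) = sqmod z.
Proof. by case: z => a b; rewrite /sqmod /= sqrrN. Qed.

Lemma sqmod0 : sqmod 0 = 0.
Proof. by rewrite /sqmod /= expr0n addr0. Qed.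

Definition orthonormal I (e : I -> H) := forall i j, '[e i, e j] = (i == j)%:R.

(** For orthonormal [e] and duplicate-free [s], this is the component of [x] orthogonal to every
    [e i] with [i] in [s]. *)
Definition residual I (e : I -> H) (s : seq I) (x : H) : H :=
  x - \sum_(i <- s) '[x, e i] *: e i.

Lemma residualD I (e : I -> H) s a x y :
  residual e s (a *: x + y) = a *: residual e s x + residual e s y.
Proof.
rewrite /residual scalerBr addrACA -opprD; congr (_ - _).
rewrite scaler_sumr -big_split /=; apply: eq_bigr => i _.
by rewrite innerDl innerZl scalerDl scalerA.
Qed.

Lemma rnorm_residual I (e : I -> H) s x : orthonormal e -> uniq s ->
  rnorm (residual e s x) ^+ 2 =
  rnorm x ^+ 2 - \sum_(i <- s) sqmod '[x, e i].
Proof.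
move=> eO us; apply: complexI; rewrite -rnorm_sqr rmorphB rmorph_sum /=.
rewrite -rnorm_sqr innerBl !innerBr.
set y := \sum_(i <- s) _.
have yx z : '[y, z] = \sum_(i <- s) '[x, e i] * '[e i, z].
  by rewrite inner_suml; apply: eq_bigr => i _; rewrite innerZl.
have yE i : i \in s -> '[y, e i] = '[x, e i].
  move=> si; rewrite yx (bigD1_seq i) //= eO eqxx mulr1.
  rewrite big1_seq ?addr0 // => j /andP[ji _].
  by rewrite eO (negbTE ji) mulr0.
have xy : '[x, y] = \sum_(i <- s) (sqmod '[x, e i])%:C.
  rewrite inner_sumr; apply: eq_bigr => i _.
  by rewrite innerZr sqmodE mulrC.
have yy : '[y, y] = '[x, y].
  rewrite [in LHS]yx [RHS]xy !big_seq; apply: eq_bigr => i si.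
  by rewrite (innerC (e i)) yE // sqmodE.
have yx' : '[y, x] = '[x, y].
  rewrite yx xy; apply: eq_bigr => i _.
  by rewrite (innerC (e i)) sqmodE.
by rewrite yy yx' subrr subr0 xy.
Qed.

Lemma bessel I (e : I -> H) s x : orthonormal e -> uniq s ->
  \sum_(i <- s) sqmod '[x, e i] <= rnorm x ^+ 2.
Proof. by move=> eO us; rewrite -subr_ge0 -rnorm_residual // sqr_ge0. Qed.

Lemma ler_sum_subseq I (f : I -> R) (s t : seq I) : (forall i, 0 <= f i) ->
  uniq s -> {subset s <= t} -> \sum_(i <- s) f i <= \sum_(i <- undup t) f i.
Proof.
move=> f0 us st; have pe : perm_eq s [seq i <- undup t | i \in s].
  apply: uniq_perm => //; first by rewrite filter_uniq ?undup_uniq.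
  move=> i; rewrite mem_filter mem_undup; case si: (i \in s) => //=.
  by rewrite st.
rewrite (perm_big _ pe) big_filter [leRHS](bigID (mem s)) /= lerDl sumr_ge0 //.
Qed.

(** Vectors with zero residual for some finite list form a subspace, because enlarging the list
    keeps a zero residual zero. For such a [y] near [x], the residual of [x] equals that of [x - y],
    and residuals do not increase norms. *)
Lemma residual_closure_lspan I (e : I -> H) x (d : R) : orthonormal e ->
  closure (lspan (range e)) x -> 0 < d ->
  exists2 s, uniq s & rnorm (residual e s x) < d.
Proof.
move=> eO cx d0.
have mono s t y : uniq s -> {subset s <= t} -> residual e s y = 0 ->
    residual e (undup t) y = 0.
  move=> us st ry; apply: rnorm_eq0; apply/eqP.
  rewrite -sqrf_eq0 eq_le sqr_ge0 andbT rnorm_residual ?undup_uniq //.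
  have := rnorm_residual y eO us; rewrite ry rnorm0 expr0n /= => h.
  rewrite [leRHS]h lerD2l lerN2; apply: ler_sum_subseq => // i; exact: sqmod_ge0.
have L : lspan (range e) `<=` [set y | exists2 s, uniq s & residual e s y = 0].
  apply: smallest_sub; last first.
    move=> _ [i _ <-]; exists [:: i] => //.
    by rewrite /residual big_seq1 eO eqxx scale1r subrr.
  apply/subspaceP; split=> [|a y z [s us sy] [t ut tz]] /=.
    by exists [::] => //; rewrite /residual big_nil subr0.
  exists (undup (s ++ t)); first exact: undup_uniq.
  rewrite residualD (mono s) ?(mono t) ?scaler0 ?addr0 // => i.
    by rewrite mem_cat => ->; rewrite orbT.
  by rewrite mem_cat => ->.
have /closure_normP/(_ _ d0)[y /L[s us sy] xy] := cx.
exists s => //; apply: le_lt_trans xy.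
have -> : residual e s x = residual e s (x - y).
  by rewrite addrC -scaleN1r residualD sy scaler0 add0r.
rewrite -ler_sqr ?nnegrE ?rnorm_ge0 // rnorm_residual // gerBl.
by apply: sumr_ge0 => i _; exact: sqmod_ge0.
Qed.

Lemma adjoint_orthogonal_images S T I (e : I -> H) :
  closed_subspace S -> bounded_operator S T -> orthonormal_basis S e ->
  (forall i j, i != j -> '[T (e i), T (e j)] = 0) ->
  forall i, adjoint S T (T (e i)) = (rnorm (T (e i)) ^+ 2)%:C *: e i.
Proof.
move=> cS bT [eS eO eC] TO i; apply: (@adjointE _ _ _ _ (range e)) => //.
  by apply: subspaceZ => //; case: cS.
move=> _ [j _ <-]; rewrite innerZr eO.
have [->|ji] := eqVneq j i; last by rewrite TO // mulr0.
by rewrite mulr1 rnorm_sqr conjR.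
Qed.

(** An orthonormal basis with pairwise orthogonal images diagonalises [T^* T], so the norms of the
    images are the singular values. *)
Lemma schatten_orthogonal_images S p T I (e : I -> H) :
  closed_subspace S -> bounded_operator S T -> orthonormal_basis S e ->
  (forall i j, i != j -> '[T (e i), T (e j)] = 0) ->
  summable_family (fun i => rnorm (T (e i)) `^ p) -> schatten S p T.
Proof.
move=> cS bT eB TO sT; split=> //.
exists I, e, (fun i => rnorm (T (e i))); split=> //.
- by move=> i; exact: rnorm_ge0.
- exact: adjoint_orthogonal_images.
- by apply/summable_family_esum => // i; exact: powR_ge0.
Qed.

(* Both [e] and [f] diagonalise [T^* T], so [e i] and [f a] can only fail to be
   orthogonal when their eigenvalues agree; the two families of eigenvalues are
   then compared through the doubly stochastic weights [|<f a, e i>|^2]. *)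
Lemma schatten_summable_images S p T I (f : I -> H) :
  closed_subspace S -> schatten S p T -> orthonormal_basis S f ->
  (forall i j, i != j -> '[T (f i), T (f j)] = 0) ->
  summable_family (fun i => rnorm (T (f i)) `^ p).
Proof.
move=> cS [bT [J [e [s [[eS eO eC] s0 sE ss]]]]] fB fO.
have [fS fN _] := fB.
have [K hK] : summable_family (fun j => s j `^ p).
  by apply/summable_family_esum => // j; exact: powR_ge0.
pose w a j := sqmod '[f a, e j].
have w0 a j : 0 <= w a j by exact: sqmod_ge0.
(* Computing the inner product of [T (f a)] and [T (e j)] from either eigenvector relation gives
   [(rnorm (T (f a)) ^+ 2 - s j ^+ 2) * '[f a, e j] = 0]. *)
have wE a j : rnorm (T (f a)) `^ p * w a j = s j `^ p * w a j.
  have h1 := (adjointP (T (e j)) cS bT).2 _ (fS a).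
  have h2 := (adjointP (T (f a)) cS bT).2 _ (eS j).
  rewrite sE innerZr conjR in h1.
  rewrite (adjoint_orthogonal_images cS bT fB fO) innerZr conjR in h2.
  rewrite innerC h2 rmorphM /= conjR -innerC in h1.
  move/eqP: h1; rewrite -subr_eq0 -mulrBl mulf_eq0 => /orP[|/eqP]; last first.
    by rewrite /w => ->; rewrite sqmod0 !mulr0.
  rewrite subr_eq0 => /eqP/complexI/eqP.
  by rewrite eqrXn2 ?rnorm_ge0 // => /eqP ->.
(* Finitely many [e j] already carry half of the unit mass of [f a]; this is the source of the
   factor 2 in [2 * K]. *)
have /choice[X /all_and2[uX hX]] : forall a, exists X, uniq X /\
    2^-1 <= \sum_(j <- X) w a j.
  move=> a; have [||X uX] := residual_closure_lspan (e := e) (x := f a) (d := 2^-1) eO.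
    by rewrite eC; exact: fS.
  - by rewrite invr_gt0.
  move=> hx; exists X; split=> //.
  have : rnorm (residual e X (f a)) ^+ 2 <= 2^-1 ^+ 2.
    by rewrite ler_sqr ?nnegrE ?rnorm_ge0 ?ltW // invr_ge0.
  rewrite rnorm_residual //.
  have -> : rnorm (f a) ^+ 2 = 1.
    by apply: complexI; rewrite -rnorm_sqr fN eqxx.
  rewrite -/(w a) => h; rewrite /w; lra.
have nE j : rnorm (e j) ^+ 2 = 1.
  by apply: complexI; rewrite -rnorm_sqr eO eqxx.
exists (2 * K) => F uF; pose Y := undup (flatten [seq X a | a <- F]).
apply: (@le_trans _ _
    (\sum_(a <- F) 2 * \sum_(j <- Y) rnorm (T (f a)) `^ p * w a j)).
  rewrite big_seq [leRHS]big_seq; apply: ler_sum => a aF.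
  rewrite -mulr_sumr mulrCA ler_peMr ?powR_ge0 //.
  rewrite -(ler_pM2l (_ : 0 < 2^-1)) ?invr_gt0 // mulr1 mulKf //.
  apply: le_trans (hX a) _; apply: ler_sum_subseq => // j jX.
  by apply/flattenP; exists (X a) => //; apply/mapP; exists a.
rewrite -mulr_sumr ler_pM2l // exchange_big /=.
apply: le_trans (hK Y (undup_uniq _)); apply: ler_sum => j _.
under eq_bigr do rewrite wE.
(* Bessel's inequality for [f] bounds the column sum of [w] at [j] by [rnorm (e j) ^+ 2 = 1]. *)
rewrite -mulr_sumr ler_piMr ?powR_ge0 // -(nE j).
apply: le_trans (bessel (e j) fN uF); apply: ler_sum => a _.
by rewrite /w innerC sqmod_conj.
Qed.

End Bases.

(** * Dickson's lemma and bounded jumps of monotone functions *)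

Section Dickson.

(** Beyond every [n] choose a position [g n] where [f] is minimal among all later positions; the
    iterates of [g] form the subsequence. *)
Lemma nondecreasing_subsequence (f : nat -> nat) :
  exists2 h : nat -> nat, {homo h : i j / (i < j)%N} &
    {homo f \o h : i j / (i <= j)%N}.
Proof.
have /choice[g /all_and2[g1 g2]] : forall n, exists k,
    (n < k)%N /\ forall l, (n < l)%N -> (f k <= f l)%N.
  move=> n; pose P v := `[< exists2 k, (n < k)%N & f k = v >].
  have exP : exists v, P v by exists (f n.+1); apply/asboolP; exists n.+1.
  case: (ex_minnP exP) => v /asboolP[k nk <-] hmin; exists k; split=> // l nl.
  by apply: hmin; apply/asboolP; exists l.
(* Starting at [g 0] rather than at 0 makes every [h n] such a minimiser. *)
pose h n := iter n.+1 g 0%N.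
have hS n : (h n < h n.+1)%N by exact: g1.
exists h; first by apply: homo_ltn hS => // x y z; exact: ltn_trans.
apply: homo_leq => [x|x y z|n] //=; first exact: leq_trans.
by apply: g2; apply: ltn_trans (g1 _) (hS n).
Qed.

Lemma nondecreasing_subsequence_seq (I : eqType) (f : nat -> I -> nat)
    (s : seq I) :
  exists2 h : nat -> nat, {homo h : i j / (i < j)%N} &
    forall l, l \in s -> {homo (fun n => f (h n) l) : i j / (i <= j)%N}.
Proof.
elim: s => [|l s [h hh hf]]; first by exists id.
have [g gh gf] := nondecreasing_subsequence (fun n => f (h n) l).
exists (h \o g) => [i j ij|l']; first by apply: hh; exact: gh.
rewrite inE => /predU1P[-> //|l's] i j ij /=; apply: hf => //.
by move: ij; rewrite leq_eqVlt => /predU1P[->//|/gh/ltnW].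
Qed.

(** Finite generation of up-sets, phrased through truncation. If every [N] had a counterexample
    [a N], pass to a subsequence nondecreasing in each coordinate: once [n] bounds the coordinates
    of its first term, that term lies below the truncation of [a (h n)] at [h n], a
    contradiction. *)
Lemma dickson (m : nat) (U : set (multi_index m)) :
  (forall a b : multi_index m, (forall i, (a i <= b i)%N) -> U a -> U b) ->
  exists N, forall a, U a -> U [ffun i => minn (a i) N].
Proof.
move=> Uup; apply: contrapT => /forallNP noN.
have /choice[a /all_and2[aU aN]] : forall N, exists a : multi_index m,
    U a /\ ~ U [ffun i => minn (a i) N].
  move=> N; have /existsNP[a /not_implyP[? ?]] := noN N; by exists a.
have [h hh hf] := nondecreasing_subsequence_seq (fun n i => a n i) (enum 'I_m).
have hn n : (n <= h n)%N by elim: n => // n IH; exact: leq_ltn_trans IH (hh _ _ _).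
pose n := \max_i a (h 0%N) i.
apply: (aN (h n)); apply: Uup (aU (h 0%N)) => i; rewrite ffunE leq_min.
rewrite (hf i) ?mem_enum //=; apply: leq_trans (hn n).
exact: (leq_bigmax (F := fun i => a (h 0%N) i)).
Qed.

(** Apply Dickson's lemma to each level set [t <= r a] with [t <= k] and take the largest bound.
    When [a i] reaches it, the truncation of [a + e_i] lies below [a], so this step cannot raise
    [r]. *)
Lemma monotone_jumps_bounded (m k : nat) (r : multi_index m -> nat) :
  (forall a b : multi_index m, (forall i, (a i <= b i)%N) -> (r a <= r b)%N) ->
  (forall a, (r a <= k)%N) ->
  exists N, forall (a : multi_index m) (i : 'I_m),
    (r a < r (a + unit_index i)%R)%N -> (a i < N)%N.
Proof.
move=> rmono rk.
have /choice[N hN] : forall t, exists N, forall a : multi_index m,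
    (t <= r a)%N -> (t <= r [ffun i => minn (a i) N])%N.
  move=> t; apply: (dickson (U := [set a | (t <= r a)%N])) => a b ab /= ta.
  exact: leq_trans ta (rmono _ _ ab).
exists (\max_(t < k.+1) N t) => a i; apply: contraTltn => Na; rewrite -leqNgt.
set b := a + unit_index i; apply: leq_trans (hN _ _ (leqnn (r b))) _.
apply: rmono => j; rewrite !ffunE.
have [->|ji] := eqVneq j i; last by rewrite addr0 geq_minl.
rewrite geq_min; apply/orP; right; apply: leq_trans Na.
have rb : (r b < k.+1)%N by rewrite ltnS.
exact: (leq_bigmax (F := fun t : 'I_k.+1 => N t) (Ordinal rb)).
Qed.

End Dickson.

(** * Orthonormal bases and projections in finite dimension *)

Section UnitaryBases.
Variables (C : numClosedFieldType) (k : nat).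
Local Open Scope sesquilinear_scope.

(** As [V] is only a predicate, take a matrix of maximal rank with row space inside [V]: adjoining a
    vector of [V] cannot raise the rank, so the row space is all of [V]. Gram-Schmidt does the
    rest. *)
Lemma subspace_unitary_basis (V : set 'rV[C]_k) :
  V 0 -> (forall a u v, V u -> V v -> V (a *: u + v)) ->
  exists r : nat, exists2 B : 'M[C]_(r, k),
    B \is unitarymx & forall v, V v <-> (v <= B)%MS.
Proof.
move=> V0 VD.
pose P n := `[< exists2 A : 'M[C]_k, \rank A = n &
  forall u : 'rV_k, (u <= A)%MS -> V u >].
have exP : exists n, P n.
  exists 0%N; apply/asboolP; exists 0; first by rewrite mxrank0.
  by move=> u; rewrite submx0 => /eqP ->.
have Pk n : P n -> (n <= k)%N by move=> /asboolP[A <- _]; exact: rank_leq_row.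
case: (ex_maxnP exP Pk) => n /asboolP[A rA AV] nmax.
have VA v : V v -> (v <= A)%MS.
  move=> Vv; have : (\rank (A + v)%MS <= \rank A)%N.
    rewrite rA; apply: nmax; apply/asboolP; exists (A + v)%MS => // u.
    move=> /sub_addsmxP[[u1 u2] /= ->].
    rewrite [u2]mx11_scalar mul_scalar_mx addrC.
    by apply: VD => //; apply: AV; exact: submxMl.
  move=> h; apply: submx_trans (addsmxSr A v) _.
  have /mxrank_leqif_sup[_ <-] := addsmxSl A v.
  by rewrite eqn_leq h mxrankS // addsmxSl.
have rk : (\rank A <= k)%N by exact: rank_leq_row.
exists (\rank A), (schmidt (row_base A)); first exact: schmidt_unitarymx.
have E : (schmidt (row_base A) :=: A)%MS.
  apply: eqmx_trans (eq_row_base A).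
  by apply: eqmx_schmidt_free; exact: row_base_free.
by move=> v; rewrite E; split=> [/VA|/AV].
Qed.

Lemma subspace_projection (V : set 'rV[C]_k) :
  V 0 -> (forall a u v, V u -> V v -> V (a *: u + v)) ->
  exists P : 'M[C]_k, [/\ P^t* = P, forall v, V (v *m P)
    & forall v, V v -> v *m P = v].
Proof.
move=> V0 VD; have [r [B uB VB]] := subspace_unitary_basis V0 VD.
exists (B^t* *m B); split=> [|v|v /VB/submxP[w ->]].
- by rewrite trmx_mul map_mxM trmxCK.
- by apply/VB; rewrite mulmxA submxMl.
- by rewrite mulmxA -(mulmxA w) (unitarymxP uB) mulmx1.
Qed.

(* A singular value decomposition of the restriction of [Q] to the row space
   of [B]. *)
Lemma unitary_basis_orthogonal_images r (B : 'M[C]_(r, k)) l (Q : 'M[C]_(k, l)) :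
  B \is unitarymx ->
  exists2 B' : 'M[C]_(r, k), B' \is unitarymx &
    (B' :=: B)%MS /\
    forall i j, i != j -> ((B' *m Q) *m (B' *m Q)^t*) i j = 0.
Proof.
move=> uB; pose N := (B *m Q) *m (B *m Q)^t*.
have NN : N \is normalmx.
  have NE : N ^t* = N.
    by rewrite /N trmx_mul map_mxM trmxCK.
  by apply/normalmxP; rewrite NE.
have /orthomx_spectralP /= NE := NN.
pose U := spectralmx N; have uU : U \is unitarymx by exact: spectral_unitarymx.
have Uu := unitarymx_unit uU.
exists (U *m B).
  apply/unitarymxP; rewrite trmx_mul map_mxM mulmxA -(mulmxA U).
  by rewrite (unitarymxP uB) mulmx1 (unitarymxP uU).
split; first by apply/eqmxMfull; rewrite row_full_unit.
move=> i j ij; rewrite -!mulmxA trmx_mul map_mxM -/U !mulmxA -(mulmxA U) -(mulmxA U).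
rewrite -mulmxA -/N [N]NE -/U -(invmx_unitary uU) !mulmxA mulmxV // mul1mx.
by rewrite mulmxK // !mxE (negbTE ij).
Qed.

End UnitaryBases.

(** * Raising and lowering multi-indices *)

Section MultiIndices.
Variable m : nat.
Implicit Types (a b : multi_index m) (i j l : 'I_m).

(** Subtraction is truncated: the result is [a] itself when [a j = 0], a case in which the
    accompanying coefficient [weight_ratio j a] vanishes. *)
Definition lower_index j a : multi_index m := [ffun l => (a l - (l == j))%N].

(** Raising comes first, so that nothing is truncated when [i = j]. *)
Definition shift_index i j a := lower_index j (a + unit_index i).

Lemma raise_indexE a i l : (a + unit_index i) l = (a l + (l == i))%N.
Proof. by rewrite !ffunE. Qed.

Lemma lower_indexK j a : (0 < a j)%N -> lower_index j a + unit_index j = a.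
Proof.
move=> aj; apply/ffunP => l; rewrite raise_indexE ffunE.
by have [->|lj] := eqVneq l j; rewrite /= ?subnK ?subn0 ?addn0.
Qed.

Lemma raise_indexK j a : lower_index j (a + unit_index j) = a.
Proof. by apply/ffunP => l; rewrite ffunE raise_indexE addnK. Qed.

Lemma shift_lower i j a : (0 < a j)%N ->
  shift_index i j a = lower_index j a + unit_index i.
Proof.
move=> aj; apply/ffunP => l; rewrite raise_indexE !ffunE.
by have [->|lj] := eqVneq l j; rewrite /= ?subn0 // addnBAC.
Qed.

Lemma shift_index_inj i j a b :
  (0 < (a + unit_index i)%R j)%N -> (0 < (b + unit_index i)%R j)%N ->
  shift_index i j a = shift_index i j b -> a = b.
Proof.
move=> ai bi /(congr1 (fun c => lower_index i (c + unit_index j))).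
by rewrite !lower_indexK // !raise_indexK.
Qed.

End MultiIndices.

(** * Weights, and the coordinate operators on [M] *)

Section Weights.
Variables (R : realType) (m : nat) (lam : multi_index m -> R).
Hypothesis lam_gt0 : forall a, 0 < lam a.
Implicit Types (a b : multi_index m) (i j l : 'I_m).

(** The coefficient of [Z^(a - e_j)] in [Z_j^* Z^a]; the Boolean factor records that this vector is
    zero when [a j = 0]. *)
Definition weight_ratio j a : R :=
  (0 < a j)%N%:R * (lam a / lam (lower_index j a)) ^+ 2.

(* [[Z_i, Z_j^*] Z^a = cross_weight i j a Z^(a + e_i - e_j)]. *)
Definition cross_weight i j a : R :=
  weight_ratio j a - weight_ratio j (a + unit_index i).

(** The eigenvalue of [Z_l^* Z_l] at [Z^b]. *)
Definition raise_ratio l b : R := weight_ratio l (b + unit_index l).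

Lemma weight_ratio_eq0 j a : a j = 0%N -> weight_ratio j a = 0.
Proof. by rewrite /weight_ratio => ->; rewrite mul0r. Qed.

Lemma weight_ratio_ge0 j a : 0 <= weight_ratio j a.
Proof. by rewrite mulr_ge0 ?sqr_ge0. Qed.

Lemma raise_ratioE l b : raise_ratio l b = (lam (b + unit_index l) / lam b) ^+ 2.
Proof.
by rewrite /raise_ratio /weight_ratio raise_indexK raise_indexE eqxx addn1 mul1r.
Qed.

Lemma cross_weight_eq0 i j a : (a + unit_index i) j = 0%N ->
  weight_ratio j a = 0 /\ weight_ratio j (a + unit_index i) = 0.
Proof.
move=> h; split; last exact: weight_ratio_eq0.
apply: weight_ratio_eq0; move: h; rewrite raise_indexE.
by move/eqP; rewrite addn_eq0 => /andP[/eqP].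
Qed.

Lemma cross_weight_neq0 i j a : cross_weight i j a != 0 ->
  (0 < (a + unit_index i)%R j)%N.
Proof.
apply: contra_neqT; rewrite -eqn0Ngt => /eqP /cross_weight_eq0[h1 h2].
by rewrite /cross_weight h1 h2 subrr.
Qed.

Variable p : R.
Hypothesis p_gt0 : 0 < p.

(* The weights telescope along the [l]-th direction: [raise_ratio l b] is the
   sum of [b l + 1] values of [- cross_weight l l]. *)
Lemma lp_raise_ratio l N :
  lp p (fun a => cross_weight l l a * (lam (shift_index l l a) / lam a)) ->
  lp p (fun b => (b l <= N)%N%:R * raise_ratio l b).
Proof.
move=> lq; have {}lq : lp p (fun a => cross_weight l l a).
  apply: lpS lq => // a; rewrite /shift_index raise_indexK divff ?mulr1 //.
  by rewrite gt_eqF.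
have lqn (P : pred (multi_index m)) : lp p (fun a => (P a)%:R * - cross_weight l l a).
  apply: lpS lq => // a; case: (P a); rewrite ?mul1r ?normrN //.
  by rewrite mul0r normr0.
(* For [b l > 0] the term [weight_ratio l b] is the raise ratio at [b - e_l]; for [b l = 0] it is
   zero. This drives the induction over the slices [b l = n]. *)
have E b : raise_ratio l b = weight_ratio l b + - cross_weight l l b.
  by rewrite /cross_weight /raise_ratio; ring.
have step n : lp p (fun b => (b l == n)%N%:R * raise_ratio l b).
  elim: n => [|n IH].
    apply: lpS (lqn (fun b => b l == 0%N)) => // b; rewrite E.
    have [/weight_ratio_eq0 ->|_] := eqVneq (b l) 0%N; first by rewrite add0r.
    by rewrite !mul0r.
  have linj : {in [pred b : multi_index m | b l == n.+1] &,
      injective (@lower_index m l)}.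
    move=> a b; rewrite !inE => /eqP al /eqP bl ab.
    by rewrite -(@lower_indexK _ l a) ?al // ab lower_indexK ?bl.
  apply: lpS (lpD p_gt0 (lp_reindex p_gt0 linj IH) (lqn (fun b => b l == n.+1))) => // b.
  rewrite /= E -mulrDr; have [bl|_] := eqVneq (b l) n.+1; last by rewrite !mul0r.
  have -> : lower_index l b l = n by rewrite ffunE eqxx bl subn1.
  by rewrite eqxx !mul1r /raise_ratio lower_indexK ?bl.
elim: N => [|N IH].
  by apply: lpS (step 0%N) => // b; rewrite leqn0.
apply: lpS (lpD p_gt0 IH (step N.+1)) => // b.
rewrite -mulrDl leq_eqVlt ltnS; have [->|_] := eqVneq (b l) N.+1.
  by rewrite ltnn add0r.
by rewrite addr0.
Qed.

Variables (M : hilbertType R) (Z : multi_index m -> M).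
Hypothesis hM : weighted_completion lam Z.

Lemma inner_monomials a b : '[Z a, Z b] = (a == b)%:R * (lam a ^+ 2)%:C.
Proof.
have [ZO ZN _] := hM; have [<-|/ZO ->] := eqVneq a b; last by rewrite mul0r.
by rewrite mul1r rnorm_sqr /rnorm ZN.
Qed.

Lemma rnorm_monomial a : rnorm (Z a) = lam a.
Proof. by have [_ ZN _] := hM; rewrite /rnorm ZN. Qed.

(** The adjoint relation of [Z_j] tested on monomials; it serves for the adjoints on [M] and on [S]
    alike. *)
Lemma inner_raise_lower j a b :
  '[Z (b + unit_index j), Z a] =
  (weight_ratio j a)%:C * '[Z b, Z (lower_index j a)].
Proof.
rewrite !inner_monomials; have [aj|] := posnP (a j).
  rewrite weight_ratio_eq0 // mul0r; case: eqVneq => [ba|_]; last by rewrite mul0r.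
  by move: aj; rewrite -ba raise_indexE eqxx addn1.
move=> aj; have -> : (b + unit_index j == a) = (b == lower_index j a).
  by apply/eqP/eqP => [<-|->]; [rewrite raise_indexK|rewrite lower_indexK].
have [->|_] := eqVneq; last by rewrite !mul0r mulr0.
rewrite lower_indexK // !mul1r -rmorphM /= /weight_ratio aj mul1r.
by rewrite expr_div_n divfK // expf_neq0 // gt_eqF.
Qed.

Lemma closure_lspan_monomials : closure (lspan (range Z)) = setT.
Proof. by have [_ _ /dense_closure] := hM. Qed.

Definition unit_monomial a : M := (lam a)^-1%:C *: Z a.

Lemma orthonormal_basis_monomials : orthonormal_basis setT unit_monomial.
Proof.
split=> // [a b|].
  rewrite innerZl innerZr inner_monomials.
  have [->|_] := eqVneq; last by rewrite mul0r !mulr0.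
  rewrite conjR mul1r -!rmorphM /=.
  have /lt0r_neq0 la := lam_gt0 b.
  by rewrite expr2 mulKf // mulVf // rmorph1.
apply/seteqP; split=> //; rewrite -closure_lspan_monomials.
apply: closure_lspan_sub.
  by apply: closed_subspace_closure; exact: subspace_lspan.
move=> _ [a _ <-].
have -> : Z a = (lam a)%:C *: unit_monomial a.
  rewrite scalerA -rmorphM /= divff ?rmorph1 ?scale1r //.
  by rewrite gt_eqF.
apply: (subspaceZ _ (subspace_closure (subspace_lspan _))).
by apply: subset_closure; apply: sub_gen_smallest; exists a.
Qed.

Variable Zop : 'I_m -> M -> M.
Hypothesis hZop : coordinate_operators Z Zop.

Lemma adjoint_coordinate j a :
  adjoint setT (Zop j) (Z a) = (weight_ratio j a)%:C *: Z (lower_index j a).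
Proof.
have [bZ ZZ] := hZop j.
apply: (@adjointE _ _ _ _ (range Z)) => //; first exact: closed_subspaceT.
  by rewrite closure_lspan_monomials.
by move=> _ [b _ <-]; rewrite ZZ innerZr conjR inner_raise_lower.
Qed.

Lemma commutator_coordinate i j a :
  commutator (Zop i) (adjoint setT (Zop j)) (Z a) =
  (cross_weight i j a)%:C *: Z (shift_index i j a).
Proof.
rewrite /commutator adjoint_coordinate (bounded_linearZ _ _ (hZop i).1) //.
rewrite !(hZop i).2 adjoint_coordinate /cross_weight rmorphB scalerBl.
congr (_ - _); have [aj|aj] := posnP (a j).
  by rewrite weight_ratio_eq0 // !scale0r.
by rewrite shift_lower.
Qed.

(** Where its coefficient is nonzero, the commutator sends distinct monomials to multiples of
    distinct monomials. The unit monomials thus have orthogonal images, whose norms are the absolute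
    values of these terms. *)
Lemma lp_cross_weight i j :
  schatten setT p (commutator (Zop i) (adjoint setT (Zop j))) ->
  lp p (fun a => cross_weight i j a * (lam (shift_index i j a) / lam a)).
Proof.
move=> sT; have [bT _] := sT.
have TE a : commutator (Zop i) (adjoint setT (Zop j)) (unit_monomial a) =
    ((lam a)^-1 * cross_weight i j a)%:C *: Z (shift_index i j a).
  rewrite (bounded_linearZ _ _ bT) // commutator_coordinate scalerA.
  by rewrite -rmorphM.
have := schatten_summable_images (closed_subspaceT M) sT orthonormal_basis_monomials.
case=> [a b ab|K hK].
  rewrite !TE innerZl innerZr inner_monomials.
  case: eqVneq => [sab|_]; last by rewrite mul0r !mulr0.
  have [->|qa] := eqVneq (cross_weight i j a) 0; first by rewrite mulr0 mul0r.
  have [->|qb] := eqVneq (cross_weight i j b) 0.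
    by rewrite mulr0 conjR mul0r mulr0.
  by move: ab; rewrite (shift_index_inj _ _ sab) ?eqxx // cross_weight_neq0.
exists K => s us; apply: le_trans (hK s us); apply: ler_sum => a _.
rewrite le_eqVlt; apply/orP; left; apply/eqP; congr (_ `^ _); rewrite TE.
rewrite rnormZR rnorm_monomial !normrM !normfV !(gtr0_norm (lam_gt0 _)).
by rewrite [RHS]mulrAC [LHS]mulrC (mulrC (lam (shift_index i j a))).
Qed.

End Weights.

(** * Cross-commutators on a closed span of monomials *)

Section MonomialSubmodule.
Variables (R : realType) (m : nat) (lam : multi_index m -> R).
Hypothesis lam_gt0 : forall a, 0 < lam a.
Variables (M : hilbertType R) (Z : multi_index m -> M).
Hypothesis hM : weighted_completion lam Z.
Variables (Zop : 'I_m -> M -> M).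
Hypothesis hZop : coordinate_operators Z Zop.
Variables (k : nat) (H : hilbertType R).
Variable tens : {bilinear M -> 'rV[R[i]]_k -> H}.
Hypothesis hH : hilbert_tensor tens.
Variable Y : 'I_m -> H -> H.
Hypothesis hY : tensored_operators tens Zop Y.

Implicit Types (a b : multi_index m) (i j l : 'I_m) (u v w : 'rV[R[i]]_k).
Local Open Scope sesquilinear_scope.

(** The matrix form lets projections pass from one argument to the other by transposition. *)
Definition vdot u v : R[i] := (u *m v^t*) 0 0.

Lemma inner_tens x y u v : '[tens x u, tens y v] = '[x, y] * vdot u v.
Proof.
rewrite hH.1 /vdot mxE; congr (_ * _).
by apply: eq_bigr => l _; rewrite !mxE.
Qed.

(** The Euclidean norm of [C^k], read off from [H] so that it inherits the norm properties; by
    [rnorm_tens] the choice of multi-index 0 is immaterial. *)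
Definition vnorm v : R := rnorm (tens (Z 0) v) / lam 0.

Lemma rnorm_tens a v : rnorm (tens (Z a) v) = lam a * vnorm v.
Proof.
have sqE b : (rnorm (tens (Z b) v) ^+ 2)%:C = (lam b ^+ 2)%:C * vdot v v.
  by rewrite -rnorm_sqr inner_tens (inner_monomials hM) eqxx mul1r.
have E : rnorm (tens (Z a) v) * lam 0 = lam a * rnorm (tens (Z 0) v).
  apply/eqP; rewrite -(@eqrXn2 _ 2) ?mulr_ge0 ?rnorm_ge0 ?ltW //; apply/eqP.
  apply: complexI; rewrite !exprMn rmorphM /= [in RHS]rmorphM /= !sqE.
  by rewrite mulrAC mulrA.
by rewrite /vnorm mulrA -E mulfK // gt_eqF.
Qed.

Lemma vnorm_ge0 v : 0 <= vnorm v.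
Proof. by rewrite divr_ge0 ?rnorm_ge0 ?ltW. Qed.

Lemma vnorm0 : vnorm 0 = 0.
Proof. by rewrite /vnorm linear0r rnorm0 mul0r. Qed.

Lemma vnormD u v : vnorm (u + v) <= vnorm u + vnorm v.
Proof.
rewrite /vnorm -mulrDl ler_wpM2r ?invr_ge0 ?(ltW (lam_gt0 0)) //.
by rewrite linearDr ler_rnormD.
Qed.

Lemma vnormZ (r : R) v : vnorm (r%:C *: v) = `|r| * vnorm v.
Proof. by rewrite /vnorm linearZr_LR /= rnormZR mulrA. Qed.

Lemma vnormN v : vnorm (- v) = vnorm v.
Proof. by rewrite /vnorm linearNr rnormN. Qed.

Variable S : set H.
Hypothesis hS : submodule Y S.

Definition monomials_in : set H := [set y | S y /\ exists a v, y = tens (Z a) v].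

(** The form in which generation by monomials enters this section: adjoints on [S] are computed and
    a basis of [S] is built from it. *)
Hypothesis SE : S = closure (lspan monomials_in).

Let V a : set 'rV[R[i]]_k := [set v | S (tens (Z a) v)].

Lemma fiber0 a : V a 0.
Proof.
by rewrite /V /= linear0r; have [[_ /subspaceP[]]] := hS.
Qed.

Lemma fiber_linear a (c : R[i]) u v : V a u -> V a v -> V a (c *: u + v).
Proof.
rewrite /V /= => Vu Vv; rewrite linearPr /=.
by have [[_ /subspaceP[_ SD]] _] := hS; exact: SD.
Qed.

Lemma raise_tens i a v : Y i (tens (Z a) v) = tens (Z (a + unit_index i)) v.
Proof. by rewrite (hY i).2 (hZop i).2. Qed.

Lemma fiber_raise a i v : V a v -> V (a + unit_index i) v.
Proof. by rewrite /V /= -raise_tens; exact: hS.2. Qed.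

Lemma fiber_lower j a v : (0 < a j)%N -> V (lower_index j a) v -> V a v.
Proof. by move=> aj /(fiber_raise j); rewrite lower_indexK. Qed.

(** Induction on the total excess of [b] over [a], lowering [b] in a coordinate where it exceeds
    [a]. *)
Lemma fiber_mono a b v : (forall l, (a l <= b l)%N) -> V a v -> V b v.
Proof.
move=> ab Va; pose d := \sum_l (b l - a l)%N.
have [n] := ubnP d; rewrite {}/d; elim: n b ab => // n IH b ab /ltnSE dn.
have [->|/eqP/ffunP ba] := eqVneq b a; first exact: Va.
have [l bl] : exists l, (a l < b l)%N.
  apply: contrapT => /forallNP h; apply: ba => l; apply/eqP.
  by rewrite eqn_leq ab andbT leqNgt; apply/negP; exact: h.
have b0 : (0 < b l)%N by exact: leq_ltn_trans bl.
apply: (fiber_lower b0); apply: IH => [l'|].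
  by rewrite ffunE; have [->|] := eqVneq l' l; rewrite ?subn0 // -ltnS subn1 prednK.
apply: leq_trans dn; rewrite (bigD1 l) //= [ltnRHS](bigD1 l) //=.
rewrite -addSn leq_add //.
  by rewrite ffunE eqxx subn1 -subSn ?prednK // -ltnS prednK.
by apply: leq_sum => l' ll'; rewrite ffunE (negbTE ll') subn0.
Qed.

Variable P : multi_index m -> 'M[R[i]]_k.
Hypothesis hP : forall a, [/\ (P a)^t* = P a, forall v, V a (v *m P a)
  & forall v, V a v -> v *m P a = v].

Lemma vdot_proj a u v : vdot u (v *m P a) = vdot (u *m P a) v.
Proof.
have [Pa _ _] := hP a.
by rewrite /vdot trmx_mul map_mxM Pa mulmxA.
Qed.

Lemma projK a : P a *m P a = P a.
Proof.
have [_ VP PV] := hP a; apply/row_matrixP => l.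
by rewrite row_mul PV // -[P a]mul1mx row_mul.
Qed.

Lemma vnorm_proj a v : vnorm (v *m P a) <= vnorm v.
Proof.
rewrite /vnorm ler_wpM2r ?invr_ge0 ?(ltW (lam_gt0 0)) //.
have -> : v = v *m P a + (v - v *m P a) by rewrite addrC subrK.
set w := v - v *m P a.
have -> : (v *m P a + w) *m P a = v *m P a.
  by rewrite /w addrC subrK.
rewrite linearDr -ler_sqr ?nnegrE ?rnorm_ge0 // rnorm_pythagoras ?lerDl ?sqr_ge0 //.
rewrite inner_tens -vdot_proj /w mulmxBl -mulmxA projK subrr.
by rewrite /vdot trmx0 map_mx0 mulmx0 mxE mulr0.
Qed.

Lemma fiberE a v : V a v <-> (v <= P a)%MS.
Proof.
have [_ VP PV] := hP a; split=> [/PV <-|/submxP[w ->]]; last exact: VP.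
exact: submxMl.
Qed.

(** Nested fibres of equal rank coincide, so [P a *m P b = P a] and [P b *m P a = P b]; taking
    adjoints identifies the two. *)
Lemma proj_eq a b : (forall v, V a v -> V b v) ->
  ~~ (\rank (P a) < \rank (P b))%N -> P a = P b.
Proof.
have sub c d : (forall v, V c v -> V d v) -> P c *m P d = P c.
  move=> cd; apply/row_matrixP => l; rewrite row_mul; have [_ _ ->] // := hP d.
  by apply: cd; apply/fiberE; exact: row_sub.
move=> ab rab; have ab' := sub _ _ ab.
have Pab : (P a <= P b)%MS by rewrite -ab' submxMl.
have Pba : (P b <= P a)%MS.
  have /mxrank_leqif_sup[_ <-] := Pab.
  by rewrite eqn_leq mxrankS //= leqNgt.
have ba' : P b *m P a = P b.
  by apply: sub => v /fiberE vb; apply/fiberE; exact: submx_trans vb Pba.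
have [Pa _ _] := hP a; have [Pb _ _] := hP b.
by rewrite -ab' -{1}Pa -{1}Pb -map_mxM -trmx_mul ba' Pb.
Qed.

Lemma bounded_raise i : bounded_operator S (Y i).
Proof.
have [_ YS] := hS; have [[_ YL [K YK]] _] := hY i.
by split=> [x /YS|a x y _ _|]; [exact|exact: YL|exists K => x _; exact: YK].
Qed.

(** The adjoint on [S] is the compression of the adjoint on [H]: the lowered vector gets projected
    onto the fibre over [a - e_j]. *)
Lemma adjoint_raise j a v : V a v -> adjoint S (Y j) (tens (Z a) v) =
  (weight_ratio lam j a)%:C *: tens (Z (lower_index j a)) (v *m P (lower_index j a)).
Proof.
move=> Vv; have [cS _] := hS; have [_ VP _] := hP (lower_index j a).
apply: (@adjointE _ _ _ _ monomials_in) => //; first exact: bounded_raise.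
  by apply: subspaceZ => //; [case: cS|exact: VP].
move=> g [Sg [b [u gE]]]; rewrite gE in Sg *.
rewrite raise_tens innerZr conjR !inner_tens.
rewrite (inner_raise_lower lam_gt0 hM) vdot_proj !mulrA.
have [<-|ba] := eqVneq b (lower_index j a).
  by have [_ _ ->] := hP b.
by rewrite (inner_monomials hM) (negbTE ba) mul0r mulr0 !mul0r.
Qed.

(** On the fibre over [a], the block of [[Y_i, Y_j^*]] into the component of [shift_index i j a],
    acting on row vectors from the right. *)
Definition cross_block i j a : 'M[R[i]]_k :=
  (weight_ratio lam j a)%:C *: P (lower_index j a) -
  (weight_ratio lam j (a + unit_index i))%:C *: P (shift_index i j a).

Local Notation cross i j := (commutator (Y i) (adjoint S (Y j))).

Lemma commutator_raise i j a v : V a v -> cross i j (tens (Z a) v) =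
  tens (Z (shift_index i j a)) (v *m cross_block i j a).
Proof.
move=> Vv; rewrite /commutator adjoint_raise //.
rewrite (bounded_linearZ _ _ (hY i).1) // !raise_tens.
rewrite adjoint_raise; last exact: fiber_raise.
rewrite /cross_block mulmxBr linearBr -!scalemxAr !linearZr_LR /=.
congr (_ - _); have [aj|aj] := posnP (a j).
  by rewrite weight_ratio_eq0 // !scale0r.
by rewrite shift_lower.
Qed.

Lemma cross_block_eq0 i j a : (a + unit_index i) j = 0%N ->
  cross_block i j a = 0.
Proof.
move=> /(cross_weight_eq0 lam)[h1 h2].
by rewrite /cross_block h1 h2 !scale0r subrr.
Qed.

Variable N : nat.
Hypothesis hN : forall a i, (\rank (P a) < \rank (P (a + unit_index i)%R))%N ->
  (a i < N)%N.

Lemma vnorm_cross_block i j a v : V a v ->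
  vnorm (v *m cross_block i j a) <=
  (`|cross_weight lam i j a| +
   [&& 0 < a j, a i <= N & shift_index i j a j <= N]%N%:R *
     (2 * weight_ratio lam j (a + unit_index i))) * vnorm v.
Proof.
move=> Vv; have v0 := vnorm_ge0 v.
set c := weight_ratio _ _ (a + _); have c0 : 0 <= c by exact: weight_ratio_ge0.
rewrite /cross_block mulmxBr -!scalemxAr -/c.
(* When [a j = 0] the block is [- c] times the projection and [cross_weight] is [- c], so the first
   term of the bound suffices. *)
have [aj|aj] := posnP (a j).
  rewrite /cross_weight weight_ratio_eq0 // scale0r !sub0r mul0r addr0 -/c.
  by rewrite vnormN vnormZ normrN ler_wpM2l ?vnorm_proj.
set g := lower_index j a; set s := shift_index i j a.
have sg : s = g + unit_index i by exact: shift_lower.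
have ag : a = g + unit_index j by rewrite lower_indexK.
have -> : (weight_ratio lam j a)%:C *: (v *m P g) - c%:C *: (v *m P s) =
    (cross_weight lam i j a)%:C *: (v *m P g) +
    c%:C *: (v *m P g - v *m P s).
  rewrite /cross_weight -/c rmorphB /= scalerBl scalerBr addrA.
  by rewrite subrK.
apply: le_trans (vnormD _ _) _; rewrite !vnormZ mulrDl lerD //.
  by rewrite ler_wpM2l ?vnorm_proj.
rewrite (ger0_norm c0).
have h2 : vnorm (v *m P g - v *m P s) <= 2 * vnorm v.
  apply: le_trans (vnormD _ _) _; rewrite vnormN.
  by have := vnorm_proj g v; have := vnorm_proj s v; lra.
(* The difference [P g - P s] is zero unless the step from [g] to [s] is proper. *)
have [gi|gi] := boolP (\rank (P g) < \rank (P s))%N; last first.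
  rewrite (proj_eq _ gi) => [|u /(fiber_raise i)]; last by rewrite -sg.
  by rewrite subrr vnorm0 mulr0 (mulr_ge0 _ v0) // mulr_ge0 // mulr_ge0.
(* If the fibres over [g] and [a] agree, then [v] lies in those over [g] and [s], and both
   projections fix it. *)
have [gj|gj] := boolP (\rank (P g) < \rank (P a))%N; last first.
  have [_ _ PVa] := hP a; have [_ _ PVs] := hP s.
  have ga : P g = P a.
    by apply: proj_eq gj => u; exact: fiber_lower.
  have Vg : V g v by apply/fiberE; rewrite ga; apply/fiberE.
  rewrite ga PVa // PVs; last by rewrite sg; exact: fiber_raise.
  by rewrite subrr vnorm0 mulr0 (mulr_ge0 _ v0) // mulr_ge0 // mulr_ge0.
rewrite sg in gi; have gN := hN gi; rewrite ag in gj; have gN' := hN gj.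
(* Each coordinate of [a] and [s] exceeds that of [g] by at most one, so the strict bound at [g]
   becomes a weak one. *)
have -> : (a i <= N)%N.
  by rewrite ag raise_indexE; case: eqVneq => _; rewrite ?addn1 ?addn0 // ltnW.
have -> : (s j <= N)%N.
  by rewrite sg raise_indexE; case: eqVneq => _; rewrite ?addn1 ?addn0 // ltnW.
by rewrite mul1r (mulrC 2) -[leRHS]mulrA ler_wpM2l.
Qed.

(** The first term comes from [[Z_i, Z_j^*]], the other two from AM-GM on the extra term. Their
    upper guards fit [lp_raise_ratio]; the positivity guard marks where the shift is injective, as
    [lp_reindex] requires. *)
Definition block_bound i j a : R :=
  `|cross_weight lam i j a * (lam (shift_index i j a) / lam a)| +
  ((a i <= N)%N%:R * raise_ratio lam i a +
   (0 < (a + unit_index i)%R j)%N%:R *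
     ((shift_index i j a j <= N)%N%:R * raise_ratio lam j (shift_index i j a))).

Lemma rnorm_commutator_raise i j a v : V a v ->
  rnorm (cross i j (tens (Z a) v)) <= block_bound i j a * rnorm (tens (Z a) v).
Proof.
move=> Vv; rewrite commutator_raise // !rnorm_tens mulrA.
set s := shift_index i j a.
apply: le_trans (ler_wpM2l (ltW (lam_gt0 s)) (vnorm_cross_block i j Vv)) _.
rewrite [leLHS]mulrA ler_wpM2r ?vnorm_ge0 // /block_bound -/s.
have la := lam_gt0 a; have ls := lam_gt0 s.
rewrite mulrDr [leRHS]mulrDl lerD //.
  rewrite normrM (gtr0_norm (divr_gt0 ls la)) -mulrA divfK ?gt_eqF //.
  by rewrite mulrC.
have r0 l b : 0 <= raise_ratio lam l b by exact: weight_ratio_ge0.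
case: and3P => [[aj -> ->]|_]; last first.
  have n0 (b : bool) (x : R) : 0 <= x -> 0 <= b%:R * x by move=> ?; rewrite mulr_ge0.
  rewrite mul0r mulr0; apply: mulr_ge0 (ltW la).
  by apply: addr_ge0; [exact: n0|exact: (n0 _ _ (n0 _ _ (r0 _ _)))].
have aj' : (0 < (a + unit_index i)%R j)%N.
  by rewrite raise_indexE; apply: leq_trans aj (leq_addr _ _).
rewrite aj' !mul1r; have sE : s + unit_index j = a + unit_index i.
  by rewrite lower_indexK.
have -> : weight_ratio lam j (a + unit_index i) = raise_ratio lam j s.
  by rewrite /raise_ratio sE.
rewrite !raise_ratioE sE; set L := lam (a + unit_index i).
(* The two raise ratios are the squares of [L / lam s] and [L / lam a]; this identity trades the
   factor [lam s] for [lam a]. *)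
have : lam s * (L / lam s) = lam a * (L / lam a).
  by rewrite mulrCA [RHS]mulrCA !divff ?gt_eqF.
move: (L / lam s) (L / lam a) => A B AB.
(* AM-GM *)
have -> : lam s * (2 * A ^+ 2) = lam a * (2 * (A * B)).
  have -> : lam s * (2 * A ^+ 2) = 2 * A * (lam s * A) by ring.
  by rewrite AB; ring.
rewrite mulrC ler_wpM2r ?(ltW la) // -subr_ge0.
have -> : B ^+ 2 + A ^+ 2 - 2 * (A * B) = (B - A) ^+ 2 by ring.
exact: sqr_ge0.
Qed.

Variable p : R.
Hypothesis p_gt0 : 0 < p.
Hypothesis Zop_schatten : forall i j,
  schatten [set: M] p (commutator (Zop i) (adjoint [set: M] (Zop j))).

Lemma lp_block_bound i j : lp p (block_bound i j).
Proof.
have lq i' j' := lp_cross_weight lam_gt0 hM hZop (@Zop_schatten i' j').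
apply: (lpD p_gt0); first by apply: (lpS p_gt0 _ (lq i j)) => a; rewrite normr_id.
apply: (lpD p_gt0); first exact: lp_raise_ratio.
apply: (@lp_reindex _ _ p_gt0 _ _
    (fun a : multi_index m => 0 < (a + unit_index i)%R j)%N (shift_index i j)
    (fun b => (b j <= N)%N%:R * raise_ratio lam j b)).
  by move=> a b; rewrite !unfold_in; exact: shift_index_inj.
exact: lp_raise_ratio.
Qed.

(** Give each fibre an orthonormal basis with orthogonal images under its block. The resulting basis
    of [S] has orthogonal images: within a block by this choice, across blocks because the shift is
    injective where blocks are nonzero. *)
Lemma schatten_commutator_raise i j : schatten S p (cross i j).
Proof.
have [cS _] := hS; have sS := cS.2.
have bT : bounded_operator S (cross i j).
  apply: bounded_commutator => //; first exact: bounded_raise.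
  by apply: bounded_adjoint => //; exact: bounded_raise.
have S0 : S 0 by case/subspaceP: sS.
(* The dimension of the fibre varies with [a], so [choice] has to select a dimension and a matrix
   together. *)
pose mx (u : {r : nat & 'M[R[i]]_(r, k)}) : 'M[R[i]]_(tag u, k) := tagged u.
have /choice[B hB] : forall a, exists u : {r : nat & 'M[R[i]]_(r, k)},
    [/\ mx u \is unitarymx, forall v, V a v <-> (v <= mx u)%MS &
      forall s t, s != t ->
        ((mx u *m cross_block i j a) *m (mx u *m cross_block i j a)^t*) s t = 0].
  move=> a; have [r [A uA VA]] := subspace_unitary_basis (@fiber0 a) (@fiber_linear a).
  have [A' uA' [AA' OA']] := unitary_basis_orthogonal_images (cross_block i j a) uA.
  exists (Tagged (fun r => 'M[R[i]]_(r, k)) A'); split=> //= v.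
  by rewrite VA AA'.
pose r a := tag (B a).
have rk a : (r a <= k)%N.
  by have [uB _ _] := hB a; rewrite /r -(mxrank_unitary uB) rank_leq_col.
pose brow (u : {a & 'I_(r a)}) := row (tagged u) (mx (B (tag u))).
pose e (u : {a & 'I_(r a)}) : H := (lam (tag u))^-1%:C *: tens (Z (tag u)) (brow u).
have Vrow (u : {a & 'I_(r a)}) : V (tag u) (brow u).
  by have [_ VB _] := hB (tag u); apply/VB; exact: row_sub.
have vdot_row n (A A' : 'M[R[i]]_(n, k)) s t :
    vdot (row s A) (row t A') = (A *m A'^t*) s t.
  by rewrite /vdot !mxE; apply: eq_bigr => x _; rewrite !mxE.
have lam0 a : lam a != 0 by rewrite gt_eqF.
have eO (u u' : {a & 'I_(r a)}) : '[e u, e u'] = (u == u')%:R.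
  rewrite innerZl innerZr inner_tens (inner_monomials hM) conjR.
  case: u u' => [a l] [b l'] /=; have [ab|ab] := eqVneq a b; last first.
    rewrite mul0r !mul0r !mulr0; case: eqVneq => // -[E].
    by rewrite E eqxx in ab.
  move: l'; rewrite -ab => l'; rewrite mul1r eq_Tagged /=.
  have [uB _ _] := hB a; rewrite vdot_row (unitarymxP uB) mxE !mulrA.
  by rewrite -!rmorphM /= expr2 mulrA -(mulrA _^-1) mulVf // mulr1 mulVf // rmorph1 mul1r.
have eB : orthonormal_basis S e.
  have eS (u : {a & 'I_(r a)}) : S (e u) by apply: subspaceZ => //; exact: Vrow.
  split=> //; apply/seteqP; split.
    by apply: closure_lspan_sub => // _ [u _ <-].
  have sL := subspace_closure (subspace_lspan (range e)).
  rewrite {1}SE; apply: closure_lspan_sub.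
    by apply: closed_subspace_closure; exact: subspace_lspan.
  move=> g [Sg [a [v gE]]]; rewrite gE in Sg *; have [_ VB _] := hB a.
  have /submxP[w ->] := (VB v).1 Sg.
  rewrite mulmx_sum_row linear_sumr; apply: (subspace_sum _ sL) => l.
  rewrite linearZr_LR /=; apply: (subspaceZ _ sL).
  have -> : tens (Z a) (row l (mx (B a))) =
      (lam a)%:C *: e (Tagged (fun a => 'I_(r a)) l).
    by rewrite scalerA -rmorphM /= divff // rmorph1 scale1r.
  apply: (subspaceZ _ sL); apply: subset_closure; apply: sub_gen_smallest.
  by exists (Tagged (fun a => 'I_(r a)) l).
have TE (u : {a & 'I_(r a)}) : cross i j (e u) = (lam (tag u))^-1%:C *:
    tens (Z (shift_index i j (tag u))) (brow u *m cross_block i j (tag u)).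
  by rewrite (bounded_linearZ _ S0 bT) ?commutator_raise //; exact: Vrow.
apply: (schatten_orthogonal_images cS bT eB) => [u u' uu'|].
  rewrite !TE innerZl innerZr inner_tens (inner_monomials hM).
  rewrite [X in _ * (_ * X)]mulrAC.
  suff -> : (shift_index i j (tag u) == shift_index i j (tag u'))%:R *
      vdot (brow u *m cross_block i j (tag u))
           (brow u' *m cross_block i j (tag u')) = 0 :> R[i].
    by rewrite mul0r !mulr0.
  case: u u' uu' => [a l] [b l'] /= uu'.
  have [sab|_] := eqVneq; last by rewrite mul0r.
  have z v : vdot 0 v = 0 by rewrite /vdot mul0mx mxE.
  have z' v : vdot v 0 = 0 by rewrite /vdot trmx0 map_mx0 mulmx0 mxE.
  (* Where the shift truncates the block is zero; elsewhere equal shifts force equal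
     multi-indices. *)
  have [a0|a0] := posnP ((a + unit_index i)%R j).
    by rewrite cross_block_eq0 // mulmx0 z mulr0.
  have [b0|b0] := posnP ((b + unit_index i)%R j).
    by rewrite (@cross_block_eq0 _ _ b) // mulmx0 z' mulr0.
  have ab := shift_index_inj a0 b0 sab.
  move: l' uu'; rewrite -ab => l'; rewrite eq_Tagged /= => ll'.
  by rewrite /brow /= -!row_mul vdot_row; have [_ _ ->] := hB a; rewrite ?mulr0.
apply: summable_familyS (summable_family_tag rk _ (lp_block_bound i j)) => u.
  have eu : rnorm (e u) = 1.
    apply/eqP; rewrite -(@eqrXn2 _ 2) ?rnorm_ge0 //; apply/eqP.
    by apply: complexI; rewrite -rnorm_sqr eO eqxx expr1n.
  have b0 : rnorm (cross i j (e u)) <= block_bound i j (tag u).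
    have := rnorm_commutator_raise i j (Vrow u).
    have l0 : 0 <= (lam (tag u))^-1 by rewrite invr_ge0 ltW.
    move=> /(ler_wpM2l l0); rewrite mulrCA.
    rewrite -[X in X * rnorm (tens _ _)](ger0_norm l0).
    rewrite -[X in X * rnorm (cross _ _ _)](ger0_norm l0).
    rewrite -!rnormZR -/(e u) eu mulr1; apply: le_trans.
    by rewrite (bounded_linearZ _ S0 bT) //; exact: Vrow.
  apply: ge0_ler_powR; rewrite ?nnegrE ?rnorm_ge0 ?(ltW p_gt0) //.
  by apply: le_trans b0 _; exact: ler_norm.
exact: powR_ge0.
Qed.

End MonomialSubmodule.

(** * Submodules generated by monomials *)

Theorem theorem10 (R : realType) (m : nat) (hm : (1 <= m)%N)
    (p : R) (hp : 1 <= p)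
    (lam : multi_index m -> R) (lam_gt0 : forall a, 0 < lam a)
    (lam_decr : forall (a : multi_index m) (i : 'I_m), lam (a + unit_index i) <= lam a)
    (M : hilbertType R) (Z : multi_index m -> M)
    (hM : weighted_completion lam Z)
    (Zop : 'I_m -> M -> M) (hZop : coordinate_operators Z Zop)
    (Zop_schatten : forall i j,
       schatten [set: M] p (commutator (Zop i) (adjoint [set: M] (Zop j))))
    (k : nat) (hk : (1 <= k)%N)
    (H : hilbertType R) (tens : {bilinear M -> 'rV[R[i]]_k -> H})
    (hH : hilbert_tensor tens)
    (Y : 'I_m -> H -> H) (hY : tensored_operators tens Zop Y)
    (C : set (multi_index m)) (x : multi_index m -> 'rV[R[i]]_k)
    (S : set H)
    (hS : S = generated_submodule Y [set tens (Z a) (x a) | a in C]) :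
  forall i j, schatten S p (commutator (Y i) (adjoint S (Y j))).
Proof.
have sY : submodule Y S by rewrite hS; exact: submodule_generated.
have SE : S = closure (lspan (monomials_in Z tens S)).
  apply/seteqP; split; last by apply: closure_lspan_sub; [exact: sY.1|move=> y []].
  (* The closed span of the monomials in [S] is a submodule containing the generators, so it
     contains [S] by minimality. *)
  rewrite {1}hS; apply: smallest_sub; last first.
    move=> _ [a Ca <-]; apply: subset_closure; apply: sub_gen_smallest.
    by split; [rewrite hS; apply: sub_gen_smallest; exists a|exists a, (x a)].
  split; first by apply: closed_subspace_closure; exact: subspace_lspan.
  move=> i; apply: (closure_lspan_invariant (hY i).1) => y [Sy [a [v yE]]].
  split; first exact: sY.2.
  by exists (a + unit_index i), v; rewrite yE (raise_tens hZop hY).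
have /choice[P hP] := fun a => @subspace_projection _ _
  [set v | S (tens (Z a) v)] (fiber0 Z tens sY a)
  (@fiber_linear _ _ _ Z _ _ tens Y S sY a).
have rmono (a b : multi_index m) : (forall l, (a l <= b l)%N) ->
    (\rank (P a) <= \rank (P b))%N.
  move=> ab; apply/mxrankS/row_subP => l; apply/(fiberE hP).
  by apply: (fiber_mono hZop hY sY ab); apply/(fiberE hP); exact: row_sub.
have [N hN] := monotone_jumps_bounded rmono (fun a => rank_leq_row (P a)).
have p_gt0 : 0 < p by exact: lt_le_trans hp.
move=> i j.
exact: (schatten_commutator_raise lam_gt0 hM hZop hH hY sY SE hP hN p_gt0).
Qed.
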